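(* Let $G=G_{n}$ be the two-dimensional $\sqrt n\times\sqrt n$ grid on the torus, where $n$ ranges over perfect squares. 1. For $k\le\log n$ the speed-up is $S^k(G)=\Omega(k)$: there are constants $c>0$ and $N$ such that $S^k(G_n)\ge c\,k$ for all $n\ge N$ and all integers $1\le k\le\log n$. 2. For $k\ge\log^3 n$ the speed-up is $S^k(G)=o(k)$: for every $\delta>0$ there is $N$ such that $S^k(G_n)\le\delta k$ for all $n\ge N$ and all integers $k\ge\log^3 n$.
   Context: The $\sqrt n\times\sqrt n$ grid on the torus is the graph with vertex set $(\mathbb Z/\sqrt n\,\mathbb Z)^2$ in which two vertices are adjacent when they differ by $\pm1$ in exactly one coordinate and agree in the other. A simple random walk on a finite graph moves at each step from the current vertex to a uniformly random neighbor. For a finite connected graph $G$, a vertex $i$ and an integer $k\ge 1$, let $\tau_i^k$ be the first time by which every vertex of $G$ has been visited by at least one of $k$ independent simple random walks, all started at $i$ at time $0$ and moving simultaneously (the vertex occupied at time $0$ counts as visited). Put $C_i^k=E[\tau_i^k]$, $C^k(G)=\max_i C_i^k$, and $C(G)=C^1(G)$ (the cover time). The speed-up is $S^k(G)=C(G)/C^k(G)$. $\log$ denotes the natural logarithm. *)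

(* Defs.v *)
From HB Require Import structures.
From mathcomp Require Import all_boot all_order all_algebra.
From mathcomp Require Import all_classical all_reals all_analysis.

Set Implicit Arguments.
Unset Strict Implicit.
Unset Printing Implicit Defensive.

Import Order.TTheory GRing.Theory Num.Theory.

Local Open Scope classical_set_scope.
Local Open Scope ring_scope.
Local Open Scope ereal_scope.

(* [ordS] is the cyclic successor on 'I_m, so 'I_m stands for Z/mZ for every
   m > 0 (unlike 'Z_m, which is Z/2Z when m = 1). *)
Definition cycle_adj (m : nat) (a b : 'I_m) : bool :=
  (a != b) && ((b == ordS a) || (a == ordS b)).

(* Here m is the side length sqrt n, so the graph has n = m ^ 2 vertices. *)
Definition torus_adj (m : nat) : rel ('I_m * 'I_m) := fun u v =>
  (cycle_adj u.1 v.1 && (u.2 == v.2)) || ((u.1 == v.1) && cycle_adj u.2 v.2).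

Section processes.
Context {R : realType} {d : measure_display} {T : measurableType d}.
Variable P : probability T R.

Definition process_sigma (V : finType) (Y : nat -> T -> V) : set (set T) :=
  <<s [set A | exists s v, A = [set omega | Y s omega = v]] >>.

Definition mutually_independent (V : finType) (k : nat)
    (X : 'I_k -> nat -> T -> V) : Prop :=
  forall (J : {set 'I_k}) (A : 'I_k -> set T),
    (forall j, j \in J -> process_sigma (X j) (A j)) ->
    P (\bigcap_(j in [set` J]) A j) = \prod_(j in J) P (A j).

Definition step_prob (V : finType) (e : rel V) (v w : V) : R :=
  if e v w then (#|[pred u | e v u]|%:R)^-1%R else 0%R.

Definition history (V : finType) (Y : nat -> T -> V) (t : nat) (w : nat -> V) :
    set T :=
  [set omega | forall s, (s <= t)%N -> Y s omega = w s].

(* The third clause is the conditional law of the next position given the whole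
   past, with the conditioning event multiplied out. *)
Definition simple_random_walk (V : finType) (e : rel V) (i : V)
    (Y : nat -> T -> V) : Prop :=
  [/\ forall s v, measurable [set omega | Y s omega = v],
      P [set omega | Y 0%N omega = i] = 1
    & forall t (w : nat -> V),
        P (history Y t.+1 w) =
        P (history Y t w) * (step_prob e (w t) (w t.+1))%:E].

(* Equal to +oo when some vertex is never visited. *)
Definition joint_cover_time (V : finType) (k : nat)
    (X : 'I_k -> nat -> T -> V) (omega : T) : \bar R :=
  ereal_inf [set t%:R%:E | t in
    [set t : nat | forall v : V, exists j : 'I_k, exists s : nat,
       (s <= t)%N /\ X j s omega = v]].

End processes.

(* A realization, on some probability space, of k independent simple random
   walks on the graph e, all started at i.  The expected cover time depends only
   on the joint law of the walks, hence not on the realization; statements about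
   it quantify over all realizations. *)
Record walks (R : realType) (V : finType) (e : rel V) (k : nat) (i : V) :=
  Walks {
    walks_display : measure_display;
    walks_space : measurableType walks_display;
    walks_prob : probability walks_space R;
    walks_pos : 'I_k -> nat -> walks_space -> V;
    walks_srw : forall j, simple_random_walk walks_prob e i (walks_pos j);
    walks_indep : mutually_independent walks_prob walks_pos }.
Arguments walks_pos {R V e k i} w _ _ _.

Definition expected_cover_time (R : realType) (V : finType) (e : rel V)
    (k : nat) (i : V) (W : walks R e k i) : \bar R :=
  \int[walks_prob W]_omega joint_cover_time (walks_pos W) omega.

Definition max_cover_time (R : realType) (V : finType) (e : rel V) (k : nat)
    (W : forall i : V, walks R e k i) : \bar R :=
  \big[maxe/-oo]_(i : V) expected_cover_time (W i).

Definition speedup (R : realType) (V : finType) (e : rel V) (k : nat)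
    (W1 : forall i : V, walks R e 1 i) (Wk : forall i : V, walks R e k i) :
    \bar R :=
  max_cover_time W1 / max_cover_time Wk.

(* Main.v *)
Require Import Defs.
From HB Require Import structures.
From mathcomp Require Import all_boot all_order all_algebra.
From mathcomp Require Import all_classical all_reals all_analysis.
From mathcomp Require Import measurable_realfun.
From mathcomp Require Import ring lra zify.

(* Write n = m ^ 2.  All estimates come from explicit functions of the position
   that satisfy a one-step drift inequality.
   - Hitting times are at most n ln (126 n): with r the squared distance to the
     target, n ln (126 (r - 1/2)) - r decreases in mean by at least 1 per step.
     A walk then avoids a vertex up to time t with probability at most
     2 (1 - 1 / 2h)^t, and independence and a union bound over the vertices give
     C^k = O(n ln^2 n / k) for k <= ln n.
   - Hitting times between points at distance at least m^(1/2) are at least of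
     order n ln n, by a truncation of ln (r + 1) - 16 r / n; Matthews' bound for
     about m^(1/2) such points gives C >= c n ln^2 n, hence the first part.
   - For k walks, cosh (lambda d), with d the horizontal distance travelled,
     grows in mean by a factor at most exp (2 lambda^2) per step, so that
     reaching an antipodal vertex takes one of the walks time of order
     n / ln (4 k).  Hence S^k = O(ln^2 n ln (4 k)), which is o(k) as soon as
     k >= ln^3 n. *)

Import Order.TTheory GRing.Theory Num.Theory.

Local Open Scope ring_scope.

Set Implicit Arguments.
Unset Strict Implicit.
Unset Printing Implicit Defensive.

(** * Finite Markov chains *)

Section finite_chain.
Context {R : realType} {V : finType}.
Variable p : V -> V -> R.
Hypothesis p_ge0 : forall x y, 0 <= p x y.
Hypothesis p_sum1 : forall x, \sum_y p x y = 1.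

(** The sequence handed to [S] lists the [t] positions after the start, without [x], so statements
    about whole trajectories cons [x] back. Recursion on the first step lets drift inequalities
    propagate by induction on [t]. *)
Fixpoint path_prob (t : nat) (x : V) (S : pred (seq V)) : R :=
  if t is t'.+1 then \sum_y p x y * path_prob t' y (fun s => S (y :: s))
  else (S [::])%:R.

Lemma eq_path_prob t x (S1 S2 : pred (seq V)) :
  S1 =1 S2 -> path_prob t x S1 = path_prob t x S2.
Proof.
elim: t x S1 S2 => [|t IH] x S1 S2 eS /=; first by rewrite eS.
by apply: eq_bigr => y _; congr (_ * _); apply: IH => s; exact: eS.
Qed.

Lemma path_prob_ge0 t x S : 0 <= path_prob t x S.
Proof.
elim: t x S => [|t IH] x S /=; first exact: ler0n.
by apply: sumr_ge0 => y _; rewrite mulr_ge0.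
Qed.

Lemma path_prob_le1 t x S : path_prob t x S <= 1.
Proof.
elim: t x S => [|t IH] x S /=; first by case: (S _).
rewrite -(p_sum1 x); apply: ler_sum => y _.
by rewrite -[leRHS]mulr1 ler_wpM2l.
Qed.

Lemma path_prob_eq0 t x (S : pred (seq V)) :
  S =1 xpred0 -> path_prob t x S = 0.
Proof.
elim: t x S => [|t IH] x S S0 /=; first by rewrite S0.
by apply: big1 => y _; rewrite IH ?mulr0// => s; exact: S0.
Qed.

(** Off [v], the drift and [F + h <= 2 * h] bring [F + h] in mean down to at most
    [F + h - 1 <= (1 - 1 / (2 * h)) * (F + h)]. The shift by [h] also keeps the function above [h],
    so its decay carries over to the probability. *)
Lemma path_prob_avoid_le (v : V) (F : V -> R) (h : R) :
  1 <= h -> (forall x, 0 <= F x <= h) ->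
  (forall x, x != v -> \sum_y p x y * F y <= F x - 1) ->
  forall t x, path_prob t x (fun s => v \notin x :: s) <= 2 * (1 - (2 * h)^-1) ^+ t.
Proof.
move=> h1 Fb dF t x; have h0 : 0 < h by lra.
set rho := 1 - _.
have rho0 : 0 <= rho.
  by rewrite subr_ge0 invf_le1; lra.
suff H : path_prob t x (fun s => v \notin x :: s) * h <= (F x + h) * rho ^+ t.
  rewrite -(ler_pM2r h0); apply: (le_trans H).
  rewrite -mulrA [_ * h]mulrC mulrA; apply: ler_wpM2r; first exact: exprn_ge0.
  by have /andP[_] := Fb x; lra.
elim: t x => [|t IH] x.
  rewrite expr0 mulr1 /=; have /andP[F0 _] := Fb x.
  by case: (_ \notin _) => /=; lra.
have /andP[F0 Fh] := Fb x.
have [->|xv] := eqVneq x v.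
  rewrite path_prob_eq0 ?mul0r; last by move=> s; rewrite /= in_cons eqxx.
  by rewrite mulr_ge0 ?exprn_ge0//; have /andP[] := Fb v; lra.
have -> : path_prob t.+1 x (fun s => v \notin x :: s) =
    \sum_y p x y * path_prob t y (fun s => v \notin y :: s).
  apply: eq_bigr => y _; congr (_ * _); apply: eq_path_prob => s.
  by rewrite in_cons negb_or eq_sym xv.
rewrite mulr_suml.
apply: (@le_trans _ _ (\sum_y p x y * ((F y + h) * rho ^+ t))).
  by apply: ler_sum => y _; rewrite -mulrA ler_wpM2l.
have -> : \sum_y p x y * ((F y + h) * rho ^+ t) =
    (\sum_y p x y * F y + h) * rho ^+ t.
  rewrite mulrDl -{2}[h]mul1r -(p_sum1 x) !mulr_suml -big_split/=.
  by apply: eq_bigr => y _; ring.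
rewrite exprS mulrA; apply: ler_wpM2r; first exact: exprn_ge0.
have := dF x xv => dFx; apply: (@le_trans _ _ (F x - 1 + h)); first by lra.
have -> : (F x + h) * rho = F x + h - (F x + h) / (2 * h) by rewrite /rho; ring.
have : (F x + h) / (2 * h) <= 1 by rewrite ler_pdivrMr; lra.
lra.
Qed.

(** [G (X_t) / c ^ t] is a supermartingale; stop it at the first visit to [z], where [c >= 1] lets
    [c ^ t] bound the power reached by then. *)
Lemma path_prob_visit_le (z : V) (G : V -> R) (c : R) :
  1 <= c -> (forall x, 0 <= G x) ->
  (forall x, \sum_y p x y * G y <= c * G x) ->
  forall t x, path_prob t x (fun s => z \in x :: s) * G z <= c ^+ t * G x.
Proof.
move=> c1 G0 dG t x; have c0 : 0 <= c by lra.
elim: t x => [|t IH] x /=.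
  rewrite expr0 mul1r mem_seq1 eq_sym; case: eqVneq => [->|_] /=; first by rewrite mul1r.
  by rewrite mul0r.
have [->|xz] := eqVneq x z.
  apply: ler_wpM2r; first exact: G0.
  apply: le_trans (path_prob_le1 t.+1 z (fun s => z \in z :: s)) _.
  exact: exprn_ege1.
have -> : \sum_y p x y * path_prob t y (fun s => z \in x :: y :: s) =
    \sum_y p x y * path_prob t y (fun s => z \in y :: s).
  apply: eq_bigr => y _; congr (_ * _); apply: eq_path_prob => s.
  by rewrite in_cons eq_sym (negbTE xz).
rewrite mulr_suml.
apply: (@le_trans _ _ (\sum_y p x y * (c ^+ t * G y))).
  by apply: ler_sum => y _; rewrite -mulrA ler_wpM2l.
have -> : \sum_y p x y * (c ^+ t * G y) = c ^+ t * \sum_y p x y * G y.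
  by rewrite mulr_sumr; apply: eq_bigr => y _; ring.
by rewrite exprSr -mulrA; apply: (ler_wpM2l _ (dG x)); exact: exprn_ge0.
Qed.

(** * Matthews' lower bound *)

Definition harmonic_sum (n : nat) : R := \sum_(j < n) (j.+1%:R)^-1.

(* Matthews' lower bound: the expected cost of covering [U] from [x] in a
   uniformly random order, the first visit costing [g v x] and the [j]-th new
   vertex costing at least [h] with probability [1/j]. *)
Definition matthews (g : V -> V -> R) (h : R) (x : V) (U : {set V}) : R :=
  if U == finset.set0 then 0
  else (#|U|%:R)^-1 * (\sum_(v in U) g v x) + h * (harmonic_sum #|U| - 1).

Variables (g : V -> V -> R) (h : R) (A : {set V}).
Hypothesis g_ge0 : forall v x, 0 <= g v x.
Hypothesis g_diag : forall v, g v v = 0.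
Hypothesis h_ge0 : 0 <= h.
Hypothesis g_step : forall v x, x != v -> g v x - 1 <= \sum_y p x y * g v y.
Hypothesis g_far : forall u v, u \in A -> v \in A -> u != v -> h <= g v u.

(** Let [y] be in [U], [u > 0] the size of [U :\ y] and [S] the sum of [g v y] over it. Dropping the
    zero term at [y] raises the average from [S / (u + 1)] to [S / u]; by [g_far] the gain is at
    least [h / (u + 1)], which pays for the term lost by the harmonic sum. *)
Lemma matthews_remove (y : V) (U : {set V}) : U \subset A -> U != finset.set0 ->
  (#|U|%:R)^-1 * (\sum_(v in U) g v y) + h * (harmonic_sum #|U| - 1) <=
  matthews g h y (U :\ y).
Proof.
move=> UA U0; have [yU|yU] := boolP (y \in U); last first.
  have -> : U :\ y = U.
    by apply/finset.setP => z; rewrite !inE; case: eqVneq => // ->; rewrite (negbTE yU).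
  by rewrite /matthews (negbTE U0).
rewrite (cardsD1 y U) yU /= (big_setD1 y)//= g_diag add0r.
have gU : #|U :\ y|%:R * h <= \sum_(v in U :\ y) g v y.
  rewrite mulr_natl -sumr_const; apply: ler_sum => v.
  rewrite !inE => /andP[vy vU]; apply: g_far; [exact: (fintype.subsetP UA _ yU)| exact: (fintype.subsetP UA _ vU)|].
  by rewrite eq_sym.
rewrite /matthews; case: ifP => [/eqP ->|].
  by rewrite cards0 big_set0 mulr0 add0r /harmonic_sum big_ord1 invr1 subrr mulr0.
move/negbT; rewrite -card_gt0; move: gU.
set S := \sum_(v in _) _; set u := #|_| => gU u0.
rewrite add1n /harmonic_sum big_ord_recr/= -/(harmonic_sum u).
have u0R : 0 < u%:R :> R by rewrite ltr0n.
have u1R : 0 < u.+1%:R :> R by rewrite ltr0n.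
have : h / u.+1%:R <= (u%:R^-1 - u.+1%:R^-1) * S.
  have -> : u%:R^-1 - u.+1%:R^-1 = (u%:R * u.+1%:R)^-1 :> R.
    rewrite -natr1; field; rewrite (gt_eqF u0R) /=.
    by rewrite natr1 (gt_eqF u1R).
  rewrite invfM mulrC -mulrA [_^-1 * S]mulrC mulrA mulrC.
  by rewrite ler_pM2r ?invr_gt0// mulrC ler_pdivlMr// mulrC.
rewrite mulrBl; move: (_^-1 * S) (_^-1 * S) => a b.
by rewrite !mulrDr mulrN; move: (h * _) (h * _) => c e; lra.
Qed.

(** For fixed [U] the expression averages functions [g v], each losing at most 1 in mean because [x]
    differs from every [v] in [U]. Deleting the new position from [U] afterwards can only raise
    it. *)
Lemma matthews_step (x : V) (U : {set V}) : U \subset A -> U != finset.set0 ->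
  x \notin U ->
  matthews g h x U - 1 <= \sum_y p x y * matthews g h y (U :\ y).
Proof.
move=> UA U0 xU.
apply: (@le_trans _ _ (\sum_y p x y *
  ((#|U|%:R)^-1 * (\sum_(v in U) g v y) + h * (harmonic_sum #|U| - 1)))); last first.
  by apply: ler_sum => y _; apply: ler_wpM2l => //; exact: matthews_remove.
rewrite /matthews (negbTE U0).
under [leRHS]eq_bigr do rewrite mulrDr.
rewrite [leRHS]big_split/= -mulr_suml p_sum1 mul1r addrAC lerD2r.
have -> : \sum_y p x y * ((#|U|%:R)^-1 * (\sum_(v in U) g v y)) =
    (#|U|%:R)^-1 * \sum_(v in U) \sum_y p x y * g v y.
  rewrite exchange_big/= mulr_sumr; apply: eq_bigr => y _.
  by rewrite -mulr_sumr; ring.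
have cU : 0 < #|U|%:R :> R by rewrite ltr0n card_gt0.
rewrite -(ler_pM2l cU) mulrBr !mulrA mulfV ?gt_eqF// !mul1r mulr1.
rewrite -sumr_const -sumrB; apply: ler_sum => v vU; apply: g_step.
by apply: contraNneq xU => ->.
Qed.

Definition uncovered (U : {set V}) (s : seq V) : bool := ~~ (U \subset s).

Lemma uncovered_nil (U : {set V}) : uncovered U [::] = (U != finset.set0).
Proof.
congr negb; apply/fintype.subsetP/eqP => [U0|-> z]; last by rewrite inE.
by apply/finset.setP => z; rewrite inE; apply/negP => /U0.
Qed.

(** Iterates [matthews_step]: each step taken before [U] is exhausted costs at most 1, which adds up
    to the mean cover time truncated at [t]; what is left at time [t] is worth at most [M]. *)
Lemma matthews_le (M : R) :
  (forall x U, matthews g h x U <= M) ->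
  forall t x (U : {set V}), U \subset A -> x \notin U ->
  matthews g h x U <= \sum_(s < t) path_prob s x (uncovered U) +
                      M * path_prob t x (uncovered U).
Proof.
move=> LM t; elim: t => [|t IH] x U UA xU.
  rewrite big_ord0 add0r /=.
  have [->|U0] := eqVneq U finset.set0.
    by rewrite uncovered_nil eqxx mulr0 /matthews eqxx.
  by rewrite uncovered_nil (negbTE U0) mulr1.
have [->|U0] := eqVneq U finset.set0.
  rewrite {1}/matthews eqxx addr_ge0//.
    by apply: sumr_ge0 => s _; exact: path_prob_ge0.
  rewrite mulr_ge0 ?path_prob_ge0//.
  by apply: le_trans (LM x finset.set0); rewrite /matthews eqxx.
have step s : path_prob s.+1 x (uncovered U) =
    \sum_y p x y * path_prob s y (uncovered (U :\ y)).
  apply: eq_bigr => y _; congr (_ * _); apply: eq_path_prob => q.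
  rewrite /uncovered; congr negb; apply/fintype.subsetP/fintype.subsetP => H z.
    by rewrite !inE => /andP[zy /H]; rewrite in_cons (negbTE zy).
  by move=> zU; rewrite in_cons; case: eqVneq => //= zy; apply: H; rewrite !inE zy.
have P0 : path_prob 0 x (uncovered U) = 1.
  by rewrite /= uncovered_nil (negbTE U0).
have := matthews_step UA U0 xU.
rewrite big_ord_recl P0.
under [X in 1 + X]eq_bigr do rewrite lift0 step.
rewrite step exchange_big/= mulr_sumr -addrA -big_split/=.
have : \sum_y p x y * matthews g h y (U :\ y) <=
  \sum_y (\sum_(s < t) p x y * path_prob s y (uncovered (U :\ y)) +
       M * (p x y * path_prob t y (uncovered (U :\ y)))).
  apply: ler_sum => y _; rewrite -mulr_sumr mulrCA -mulrDr ler_wpM2l//.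
  apply: IH; last by rewrite !inE eqxx.
  exact: (fintype.subset_trans (finset.subD1set _ _) UA).
move: (\sum_y _) (\sum_y _) => a b; lra.
Qed.

Lemma matthews_ge x (U : {set V}) : 0 <= h * (harmonic_sum #|U| - 1) ->
  h * (harmonic_sum #|U| - 1) <= matthews g h x U.
Proof.
rewrite /matthews; case: ifP => [/eqP ->|_ _].
  by rewrite cards0 /harmonic_sum big_ord0 sub0r mulrN1 oppr_ge0 oppr_le0.
rewrite -[leLHS]add0r lerD2r mulr_ge0 ?invr_ge0 ?ler0n//.
by apply: sumr_ge0 => v _.
Qed.

End finite_chain.

(** * The law of a random walk *)

Section finite_valued.
Local Open Scope classical_set_scope.
Context {R : realType} {d : measure_display} {T : measurableType d}.
Variable P : probability T R.

Lemma measurable_exists (I : countType) (F : I -> set T) :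
  (forall i, measurable (F i)) -> measurable [set omega | exists i, F i omega].
Proof.
move=> mF; rewrite (_ : [set _ | _] = \bigcup_i F i).
  exact: countable_bigcupT_measurable.
by apply/seteqP; split => [w [i Fw]|w [i _ Fw]]; exists i.
Qed.

Lemma measurable_bool (b : bool) : measurable [set omega : T | b].
Proof.
case: b; first by rewrite (_ : [set _ | _] = setT)//; apply/seteqP; split.
by rewrite (_ : [set _ | _] = set0)//; apply/seteqP; split.
Qed.

Lemma probability_fiber_sum (V : finType) (f : T -> V) (A : set T) :
  (forall v, measurable [set omega | f omega = v]) -> measurable A ->
  P A = (\sum_v P (A `&` [set omega | f omega = v]))%E.
Proof.
move=> mf mA.
have H (r : seq V) : uniq r ->
    P (A `&` [set omega | f omega \in r]) =
    (\sum_(v <- r) P (A `&` [set omega | f omega = v]))%E /\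
    measurable (A `&` [set omega | f omega \in r]).
  elim: r => [_|v r IH /= /andP[vr /IH[Pr mr]]].
    rewrite (_ : _ `&` _ = set0) ?big_nil ?measure0//.
    by apply/seteqP; split => // w [].
  have -> : A `&` [set omega | f omega \in v :: r] =
      (A `&` [set omega | f omega = v]) `|` (A `&` [set omega | f omega \in r]).
    apply/seteqP; split => w /=.
      by rewrite in_cons => -[Aw /orP[/eqP ->|fr]]; [left|right].
    by rewrite in_cons => -[[Aw ->]|[Aw ->]]; rewrite ?eqxx ?orbT.
  split; last by apply: measurableU => //; exact: measurableI.
  rewrite big_cons -Pr measureU//; first exact: measurableI.
  apply/seteqP; split => // w [[_ /= fv] [_ /=]].
  by rewrite fv (negbTE vr).
rewrite -(H _ (index_enum_uniq V)).1; congr (P _).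
by apply/seteqP; split => w //=; [rewrite mem_index_enum|case].
Qed.

Lemma probability_exists_le (I : finType) (F : I -> set T) :
  (forall i, measurable (F i)) ->
  (P [set omega | exists i, F i omega] <= \sum_i P (F i))%E.
Proof.
move=> mF.
have H (r : seq I) :
    (P [set omega | exists2 i, i \in r & F i omega] <= \sum_(i <- r) P (F i))%E
    /\ measurable [set omega | exists2 i, i \in r & F i omega].
  elim: r => [|i r [IH mr]].
    rewrite (_ : [set _ | _] = set0) ?big_nil ?measure0//.
    by apply/seteqP; split => // w [].
  have -> : [set omega | exists2 j, j \in i :: r & F j omega] =
      F i `|` [set omega | exists2 j, j \in r & F j omega].
    apply/seteqP; split => w /=.
      move=> [j]; rewrite in_cons => /orP[/eqP ->|jr] Fw; first by left.
      by right; exists j.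
    by move=> [Fw|[j jr Fw]]; [exists i|exists j]; rewrite // in_cons ?eqxx ?jr ?orbT.
  split; last exact: measurableU.
  rewrite big_cons; apply: le_trans (leeD2l _ IH).
  exact: measureU2.
apply: le_trans (H (index_enum I)).1.
rewrite le_measure ?inE//; [exact: measurable_exists|exact: (H _).2|].
by move=> w [i Fw]; exists i => //; rewrite mem_index_enum.
Qed.

End finite_valued.

Section walk_law.
Local Open Scope classical_set_scope.
Context {R : realType} {d : measure_display} {T : measurableType d}.
Variables (P : probability T R) (V : finType) (e : rel V) (i : V).
Variable Y : nat -> T -> V.
Hypothesis srwY : simple_random_walk P e i Y.

Definition segment (a t : nat) (omega : T) : seq V :=
  [seq Y s omega | s <- iota a t].

Lemma measurable_position s v : measurable [set omega | Y s omega = v].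
Proof. by case: srwY. Qed.

Lemma measurable_segment a t (S : pred (seq V)) :
  measurable [set omega | S (segment a t omega)].
Proof.
elim: t a S => [|t IH] a S; first exact: (measurable_bool (S [::])).
rewrite (_ : [set _ | _] = [set omega | exists v, ([set omega | Y a omega = v] `&`
    [set omega | S (v :: segment a.+1 t omega)]) omega]).
  by apply: measurable_exists => v; apply: measurableI; [exact: measurable_position|exact: IH (fun s => S (v :: s))].
apply/seteqP; split => w /=; first by move=> Sw; exists (Y a w).
by move=> [v [<-]].
Qed.

Lemma measurable_history t w : measurable (history Y t w).
Proof.
rewrite (_ : history Y t w =
  [set omega | segment 0 t.+1 omega == [seq w s | s <- iota 0 t.+1]]).
  exact: (measurable_segment 0 t.+1 (fun q => q == [seq w s | s <- iota 0 t.+1])).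
apply/seteqP; split => omega /= H.
  by apply/eqP/eq_in_map => s; rewrite mem_iota add0n /= ltnS => /H.
move=> s st; move/eqP: H => /eq_in_map; apply.
by rewrite mem_iota.
Qed.

(** The Markov property: split according to the next position, the third clause of
    [simple_random_walk] supplying one factor per step. *)
Lemma history_segment t s w (S : pred (seq V)) :
  P (history Y s w `&` [set omega | S (segment s.+1 t omega)]) =
  (P (history Y s w) * (path_prob (step_prob e) t (w s) S)%:E)%E.
Proof.
elim: t s w S => [|t IH] s w S.
  rewrite /segment /=; case: (S [::]).
    by rewrite mule1; congr (P _); apply/seteqP; split => [? []|].
  by rewrite mule0 (_ : _ `&` _ = set0) ?measure0//; apply/seteqP; split => [? []|].
rewrite (probability_fiber_sum _ (measurable_position s.+1)); last first.
  by apply: measurableI; [exact: measurable_history|exact: measurable_segment].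
rewrite /= -sumEFin ge0_sume_distrr; last first.
  move=> v _; rewrite lee_fin mulr_ge0//; last first.
    by apply: path_prob_ge0 => x y; rewrite /step_prob; case: ifP.
  by rewrite /step_prob; case: ifP.
apply: eq_bigr => v _.
(* The history prolonged by the value [v] at time [s + 1]. *)
pose w' r := if (r <= s)%N then w r else v.
have ws : w' s = w s by rewrite /w' leqnn.
have ws1 : w' s.+1 = v by rewrite /w' ltnn.
have hw : history Y s w' = history Y s w.
  by apply/seteqP; split => omega H r rs; have := H r rs; rewrite /w' rs.
have -> : history Y s w `&` [set omega | S (segment s.+1 t.+1 omega)] `&`
    [set omega | Y s.+1 omega = v] =
    history Y s.+1 w' `&` [set omega | S (v :: segment s.+2 t omega)].
  apply/seteqP; split => omega /=.
    move=> [[H Sw] Yv]; split; last by rewrite -Yv.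
    move=> r; rewrite leq_eqVlt => /orP[/eqP ->|]; first by rewrite ws1.
    by rewrite ltnS /w' => rs; rewrite rs; exact: H.
  move=> [H Sw].
  have Yv : Y s.+1 omega = v by rewrite H.
  split=> //; split; last by rewrite /segment /= Yv.
  by move=> r rs; have := H r (leqW rs); rewrite /w' rs.
rewrite (IH s.+1 w' (fun q => S (v :: q))) ws1.
have [_ _ ->] := srwY.
by rewrite hw ws ws1 -muleA -EFinM.
Qed.

Lemma walk_law t (S : pred (seq V)) :
  P [set omega | S (segment 0 t.+1 omega)] =
  (path_prob (step_prob e) t i (fun s => S (i :: s)))%:E.
Proof.
have [_ P0 _] := srwY.
have m0 := measurable_position 0 i.
have mS := measurable_segment 0 t.+1 S.
have h0 : history Y 0 (fun=> i) = [set omega | Y 0 omega = i].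
  apply/seteqP; split => omega /=; first exact.
  by move=> Y0 [|].
have := history_segment t 0 (fun=> i) (fun s => S (i :: s)).
rewrite h0 P0 mul1e => <-.
set A := [set omega | S (segment 0 t.+1 omega)] in mS *.
set B := [set omega | Y 0 omega = i] in m0 P0 *.
have -> : B `&` [set omega | S (i :: segment 1 t omega)] = A `&` B.
  apply/seteqP; split => omega.
    by move=> [BO /=]; rewrite -{1}BO => AO; split.
  by move=> [AO BO]; split => //=; rewrite -BO.
(* The walk starts at [i] only almost surely, so the part of the event off [B] is discarded as a
   null set. *)
have mB' : measurable (~` B) by exact: measurableC.
have AB0 : P (A `&` ~` B) = 0%E.
  apply/eqP; rewrite eq_le measure_ge0 andbT.
  apply: (@le_trans _ _ (P (~` B))); last by rewrite probability_setC// P0 subee.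
  by rewrite le_measure ?inE//; exact: measurableI.
rewrite -[A in LHS](setIT A) -(setUv B) setIUr measureU.
- by rewrite [X in (_ + X)%E](_ : _ = 0%E) ?adde0//; exact: AB0.
- exact: measurableI.
- exact: measurableI.
- by rewrite setIACA setICr setI0.
Qed.

Lemma mem_segment t v omega :
  (v \in segment 0 t.+1 omega) <-> exists s, (s <= t)%N /\ Y s omega = v.
Proof.
split.
  by move/mapP => [s]; rewrite mem_iota add0n /= ltnS => st ->; exists s.
by move=> [s [st <-]]; apply/map_f; rewrite mem_iota.
Qed.

(** Puts avoidance in the sigma-algebra of a single walk, as [mutually_independent] demands. *)
Lemma process_sigma_avoid t v :
  process_sigma Y [set omega | v \notin segment 0 t.+1 omega].
Proof.
rewrite (_ : [set _ | _] = ~` (\bigcup_s (if (s <= t)%N then [set omega | Y s omega = v] else set0))).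
  apply: sigma_algebraC; apply: sigma_algebra_bigcup => s.
  case: ifP => _; last exact: sigma_algebra0.
  by apply: sub_sigma_algebra; exists s, v.
apply/seteqP; split => omega /= H.
  move=> [s _]; case: ifP => // st Ys.
  by move/negP: H; apply; apply/mem_segment; exists s.
apply/negP => /mem_segment[s [st Ys]]; apply: H.
by exists s => //; rewrite st.
Qed.

End walk_law.

(** * Cover times *)

Section cover_time.
Local Open Scope classical_set_scope.
Context {R : realType} {d : measure_display} {T : measurableType d}.
Variables (P : probability T R) (V : finType) (e : rel V) (i : V) (k : nat).
Variable X : 'I_k -> nat -> T -> V.
Hypothesis srwX : forall j, simple_random_walk P e i (X j).

Definition not_covered (t : nat) : set T :=
  [set omega | exists v, forall j, v \notin segment (X j) 0 t.+1 omega].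

Lemma measurable_avoid t v :
  measurable [set omega | forall j, v \notin segment (X j) 0 t.+1 omega].
Proof.
rewrite (_ : [set _ | _] = ~` [set omega | exists j, v \in segment (X j) 0 t.+1 omega]).
  apply: measurableC; apply: measurable_exists => j.
  exact: (measurable_segment (srwX j) 0 t.+1 (fun q => v \in q)).
apply/seteqP; split => omega /= H; first by move=> [j]; apply/negP.
by move=> j; apply/negP => vj; apply: H; exists j.
Qed.

Lemma measurable_not_covered t : measurable (not_covered t).
Proof. by apply: measurable_exists => v; exact: measurable_avoid. Qed.

Lemma not_coveredPn t omega : ~ not_covered t omega <->
  forall v, exists j s, (s <= t)%N /\ X j s omega = v.
Proof.
split=> [H v|H [v Hv]].
  apply: contrapT => Hv; apply: H; exists v => j; apply/negP => /mem_segment Hj.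
  by apply: Hv; exists j.
have [j Hj] := H v; move/negP: (Hv j); apply; exact/mem_segment.
Qed.

Lemma not_covered_anti s t : (s <= t)%N -> not_covered t `<=` not_covered s.
Proof.
move=> st omega [v Hv]; exists v => j; apply: contra (Hv j) => /mem_segment[r [rs Xr]].
by apply/mem_segment; exists r; split => //; exact: leq_trans rs st.
Qed.

(** The tail-sum formula, pointwise: the events decrease in [t], so the indicators are 1 before the
    first covering time and 0 from then on. If covering never happens, both the infimum of the empty
    set and the series are infinite. *)
Lemma joint_cover_timeE omega :
  joint_cover_time X omega = (\sum_(t <oo) (\1_(not_covered t) omega : R)%:E)%E.
Proof.
rewrite /joint_cover_time.
have f0 t : (0 <= (\1_(not_covered t) omega : R)%:E)%E by rewrite lee_fin.
have [[t Ht]|H] := pselect (exists t, ~ not_covered t omega); last first.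
  rewrite (_ : [set _ | _ in _] = set0); last first.
    apply/seteqP; split => // x [t /not_coveredPn Ht _].
    by exfalso; apply: H; exists t.
  rewrite ereal_inf0; apply/esym/eq_infty => r.
  apply: le_trans (@nneseries_lim_ge _ _ xpredT 0 (Num.bound `|r|) _); last by [].
  rewrite (eq_bigr (fun=> 1%E)); last first.
    move=> t _; rewrite indicE mem_set//; apply: contrapT => Ht; apply: H.
    by exists t.
  rewrite sumEFin lee_fin sumr_const_nat subn0.
  by apply: le_trans (ler_norm r) _; exact: ltW (archi_boundP (normr_ge0 r)).
have exT : exists t, `[< ~ not_covered t omega >] by exists t; exact/asboolP.
case: (ex_minnP exT) => t0 /asboolP Ht0 mint0 {t Ht exT}.
rewrite (nneseries_split 0 t0)// [X in (_ + X)%E]eseries0 ?adde0; last first.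
  move=> t t0t _; rewrite indicE memNset// => Ht; apply: Ht0.
  exact: not_covered_anti Ht.
rewrite add0n big_nat_cond (eq_bigr (fun=> 1%E)); last first.
  move=> t; rewrite andbT => /andP[_ tt0]; rewrite indicE mem_set//.
  apply: contrapT => Ht; have := mint0 t; rewrite leqNgt tt0 => /(_ _)/negP.
  by move/(_ (asboolT Ht)).
rewrite -big_nat_cond sumEFin sumr_const_nat subn0.
apply/eqP; rewrite eq_le; apply/andP; split.
  by apply: ereal_inf_lbound; exists t0 => //; exact/not_coveredPn.
apply: le_ereal_inf_tmp => x [t /not_coveredPn Ht <-].
by rewrite lee_fin ler_nat; apply: mint0; exact/asboolP.
Qed.

Lemma integral_cover_time :
  (\int[P]_omega joint_cover_time X omega = \sum_(t <oo) P (not_covered t))%E.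
Proof.
rewrite (eq_integral (fun omega => \sum_(t <oo) (\1_(not_covered t) omega : R)%:E)%E); last first.
  by move=> omega _; exact: joint_cover_timeE.
rewrite integral_nneseries//.
- apply: eq_eseriesr => t _; rewrite integral_indic ?setIT//.
  exact: measurable_not_covered.
- move=> t; apply/measurable_EFinP; apply: measurable_indic.
  exact: measurable_not_covered.
Qed.

Lemma integral_cover_time_ge (n : nat) :
  (\sum_(0 <= t < n) P (not_covered t) <= \int[P]_omega joint_cover_time X omega)%E.
Proof. by rewrite integral_cover_time; exact: nneseries_lim_ge. Qed.

Lemma integral_cover_time_le (C : \bar R) :
  (forall n, (\sum_(0 <= t < n) P (not_covered t) <= C)%E) ->
  (\int[P]_omega joint_cover_time X omega <= C)%E.
Proof.
move=> H; rewrite integral_cover_time; apply: lime_le.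
  exact: is_cvg_nneseries.
by apply: nearW => n; exact: H.
Qed.

(** By a union bound over the walks, [z] is unvisited at time [t] with probability at least
    [1 - k * q]. This bounds the [t + 1] terms of the tail sum up to time [t], since [not_covered]
    decreases. *)
Lemma expected_cover_time_ge_visit (z : V) (t : nat) (q : R) :
  path_prob (step_prob e) t i (fun s => z \in i :: s) <= q ->
  ((t.+1%:R * (1 - k%:R * q))%:E <= \int[P]_omega joint_cover_time X omega)%E.
Proof.
move=> Hq.
have Pnc : ((1 - k%:R * q)%:E <= P (not_covered t))%E.
  have mE (j : 'I_k) : measurable [set omega | z \in segment (X j) 0 t.+1 omega].
    exact: (measurable_segment (srwX j) 0 t.+1 (fun s => z \in s)).
  have mE' : measurable [set omega | exists j, z \in segment (X j) 0 t.+1 omega].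
    exact: measurable_exists.
  apply: (@le_trans _ _ (P (~` [set omega | exists j, z \in segment (X j) 0 t.+1 omega]))); last first.
    rewrite le_measure ?inE//; [exact: measurableC|exact: measurable_not_covered|].
    by move=> omega H; exists z => j; apply/negP => zj; apply: H; exists j.
  rewrite probability_setC// EFinB leeB//.
  apply: le_trans (probability_exists_le P mE) _.
  apply: (@le_trans _ _ (\sum_(j < k) q%:E)%E).
    apply: lee_sum => j _; rewrite (walk_law (srwX j) t (fun s => z \in s)).
    by rewrite lee_fin.
  by rewrite sumEFin lee_fin sumr_const card_ord mulr_natl.
apply: le_trans (integral_cover_time_ge t.+1).
apply: (@le_trans _ _ (\sum_(0 <= s < t.+1) (1 - k%:R * q)%:E)%E).
  by rewrite sumEFin lee_fin sumr_const_nat subn0 mulr_natl.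
rewrite big_nat_cond [leRHS]big_nat_cond; apply: lee_sum => s.
rewrite andbT ltnS => /andP[_ st].
apply: le_trans Pnc _; rewrite le_measure ?inE//; try exact: measurable_not_covered.
exact: not_covered_anti.
Qed.

(** Independence makes [q ^ k] bound the probability that all walks miss a given vertex; a union
    bound over the vertices concludes. *)
Lemma probability_not_covered_le (t : nat) (q : R) :
  mutually_independent P X -> 0 <= q ->
  (forall v, path_prob (step_prob e) t i (fun s => v \notin i :: s) <= q) ->
  (P (not_covered t) <= (#|V|%:R * q ^+ k)%:E)%E.
Proof.
move=> indep q0 Hq.
have capE (v : V) : [set omega | forall j, v \notin segment (X j) 0 t.+1 omega] =
    \bigcap_(j in [set` [set: 'I_k]%SET]) [set omega | v \notin segment (X j) 0 t.+1 omega].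
  apply/seteqP; split => omega /= H; first by move=> j _; exact: H.
  by move=> j; apply: H; rewrite /= inE.
apply: le_trans (probability_exists_le P _) _.
  by move=> v; exact: measurable_avoid.
apply: (@le_trans _ _ (\sum_(v : V) (q ^+ k)%:E)%E); last first.
  by rewrite sumEFin lee_fin sumr_const mulr_natl.
apply: lee_sum => v _; rewrite [A in P A](capE v) indep; last first.
  by move=> j _; exact: process_sigma_avoid.
under eq_bigr => j _ do rewrite (walk_law (srwX j) t (fun s => v \notin s)).
rewrite prodEFin lee_fin prodr_const cardsT card_ord lerXn2r ?nnegrE//.
by apply: path_prob_ge0 => x y; rewrite /step_prob; case: ifP.
Qed.

End cover_time.

Lemma sum_geometric_tail_le (R : realType) (a : nat -> R) (rho : R) (t0 n : nat) :
  0 <= rho < 1 -> (forall t, 0 <= a t <= 1) ->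
  (forall t, a (t0 + t)%N <= rho ^+ t) ->
  \sum_(0 <= t < n) a t <= t0%:R + (1 - rho)^-1.
Proof.
move=> /andP[rho0 rho1] a01 arho.
apply: (@le_trans _ _ (\sum_(0 <= t < t0 + n) a t)).
  rewrite (@big_cat_nat _ _ _ n 0 (t0 + n))//= ?leq_addl// lerDl.
  by apply: sumr_ge0 => t _; have /andP[] := a01 t.
rewrite (@big_cat_nat _ _ _ t0 0 (t0 + n))//= ?leq_addr//; apply: lerD.
  apply: (@le_trans _ _ (\sum_(0 <= t < t0) 1)).
    by apply: ler_sum => t _; have /andP[] := a01 t.
  by rewrite sumr_const_nat subn0.
rewrite -{1}[t0]add0n big_addn addnC addnK.
apply: (@le_trans _ _ (\sum_(0 <= t < n) rho ^+ t)).
  by apply: ler_sum => t _; rewrite addnC.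
have rho1' : 0 < 1 - rho by rewrite subr_gt0.
rewrite -(ler_pM2l rho1') mulfV ?gt_eqF// big_mkord.
have -> : (1 - rho) * \sum_(t < n) rho ^+ t = 1 - rho ^+ n.
  by have := subrX1 rho n; rewrite /=; lra.
by rewrite gerBl exprn_ge0.
Qed.

(** * Cover times from drift functions *)

Section cover_bounds.
Context {R : realType} {V : finType} {e : rel V}.
Hypothesis step1 : forall x, \sum_y step_prob e x y = 1 :> R.

Lemma step_prob_ge0 x y : 0 <= step_prob e x y :> R.
Proof. by rewrite /step_prob; case: ifP. Qed.

Lemma expected_cover_time_le (k : nat) (i : V) (W : walks R e k i) (h : R)
    (F : V -> V -> R) : (0 < k)%N -> 1 <= h ->
  (forall v x, 0 <= F v x <= h) ->
  (forall v x, x != v -> \sum_y step_prob e x y * F v y <= F v x - 1) ->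
  (expected_cover_time W <= (2 * h * (3 + ln #|V|%:R / k%:R))%:E)%E.
Proof.
move=> k0 h1 Fb dF.
have h0 : 0 < h by lra.
have V0 : 0 < #|V|%:R :> R by rewrite ltr0n; apply/card_gt0P; exists i.
have V1 : 1 <= #|V|%:R :> R by rewrite ler1n -(ltr0n R).
have lnV0 : 0 <= ln #|V|%:R :> R by rewrite ln_ge0.
have kR : 0 < k%:R :> R by rewrite ltr0n.
set rho := 1 - (2 * h)^-1.
have ih0 : 0 < (2 * h)^-1 by rewrite invr_gt0; lra.
have ih1 : (2 * h)^-1 <= 1 by rewrite invf_le1; lra.
have rho01 : 0 <= rho < 1 by apply/andP; rewrite /rho; split; lra.
have /andP[rho0 rho1] := rho01.
(* Chosen so that [rho ^ t0 <= exp (- (1 + ln #|V| / k))]: the second term beats the factor [#|V|]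
   of the union bound, and the [1] beats the factor 2 of [path_prob_avoid_le], as [2 <= e]. Past
   [t0] a geometric series of sum [2 * h] dominates. *)
set x := 2 * h * (1 + ln #|V|%:R / k%:R).
have x0 : 0 <= x by rewrite mulr_ge0 ?addr_ge0 ?divr_ge0//; lra.
have /andP[tx xt] := truncn_itv x0.
set t0 := (Num.truncn x).+1 in xt.
pose a t : R := fine (walks_prob W (not_covered (walks_pos W) t)).
have mN t := measurable_not_covered (walks_srw W) t.
have aE t : walks_prob W (not_covered (walks_pos W) t) = (a t)%:E.
  by rewrite fineK// fin_num_measure.
have a01 t : 0 <= a t <= 1.
  by rewrite -!lee_fin -aE measure_ge0 probability_le1.
have arho t : a t <= #|V|%:R * (2 * rho ^+ t) ^+ k.
  rewrite -lee_fin -aE.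
  apply: (probability_not_covered_le (walks_srw W) (@walks_indep _ _ _ _ _ W)).
    by rewrite mulr_ge0 ?exprn_ge0.
  by move=> v; apply: (path_prob_avoid_le step_prob_ge0 step1 h1 (Fb v) (dF v)).
have rhot0 : rho ^+ t0 <= expR (- (1 + ln #|V|%:R / k%:R)).
  apply: (@le_trans _ _ (expR (- (2 * h)^-1) ^+ t0)).
    by rewrite lerXn2r ?nnegrE ?expR_ge0//; exact: expR_ge1Dx.
  rewrite -expRM_natr ler_expR mulNr lerN2 [leRHS]mulrC ler_pdivlMr; last by lra.
  by rewrite [leLHS]mulrC -/x ltW.
have Vt0 : #|V|%:R * (2 * rho ^+ t0) ^+ k <= 1.
  apply: (@le_trans _ _ (#|V|%:R * (expR (- (ln #|V|%:R / k%:R))) ^+ k)).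
    rewrite ler_pM2l// lerXn2r ?nnegrE ?expR_ge0 ?mulr_ge0 ?exprn_ge0//.
    apply: (@le_trans _ _ (2 * expR (- (1 + ln #|V|%:R / k%:R)))).
      by rewrite ler_pM2l.
    rewrite opprD expRD mulrA ger_pMl ?expR_gt0// expRN ler_pdivrMr ?expR_gt0//.
    by rewrite mul1r; have := @expR_ge1Dx R 1; lra.
  rewrite -expRM_natr mulNr divfK ?gt_eqF// expRN lnK ?posrE//.
  by rewrite mulfV ?gt_eqF.
apply: integral_cover_time_le; first exact: walks_srw.
move=> n; under eq_bigr do rewrite aE.
rewrite sumEFin lee_fin.
apply: (@le_trans _ _ (t0%:R + (1 - rho)^-1)).
  apply: sum_geometric_tail_le => // t.
  apply: le_trans (arho _) _.
  have -> : #|V|%:R * (2 * rho ^+ (t0 + t)) ^+ k =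
      #|V|%:R * (2 * rho ^+ t0) ^+ k * (rho ^+ t) ^+ k.
    by rewrite exprD -mulrA -exprMn -mulrA.
  apply: (@le_trans _ _ ((rho ^+ t) ^+ k)).
    by apply: ler_piMl => //; rewrite !exprn_ge0.
  by apply: ler_iXnr => //; rewrite ?exprn_ge0// exprn_ile1 // ltW.
have -> : (1 - rho)^-1 = 2 * h by rewrite /rho opprB addrC subrK invrK.
have : t0%:R <= x + 1 by rewrite /t0 -natr1 lerD2r.
rewrite /x; lra.
Qed.

Lemma expected_cover_time_ge (i : V) (W : walks R e 1 i) (g : V -> V -> R) (h : R)
    (A : {set V}) :
  (forall v x, 0 <= g v x) -> (forall v, g v v = 0) -> 0 <= h ->
  (forall v x, x != v -> g v x - 1 <= \sum_y step_prob e x y * g v y) ->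
  (forall u v, u \in A -> v \in A -> u != v -> h <= g v u) ->
  0 <= h * (harmonic_sum #|A :\ i| - 1) ->
  ((h * (harmonic_sum #|A :\ i| - 1) / 2)%:E <= expected_cover_time W)%E.
Proof.
move=> g0 gd h0 gs gf L0.
set nc := not_covered (walks_pos W).
have mN t := measurable_not_covered (walks_srw W) t.
pose a t : R := fine (walks_prob W (nc t)).
have aE t : walks_prob W (nc t) = (a t)%:E.
  by rewrite fineK// fin_num_measure.
have a0 t : 0 <= a t by rewrite -lee_fin -aE measure_ge0.
have a_anti s t : (s <= t)%N -> a t <= a s.
  move=> st; rewrite -lee_fin -!aE le_measure ?inE//.
  exact: not_covered_anti.
have pa t : path_prob (step_prob e) t i (uncovered (A :\ i)) <= a t.
  rewrite -lee_fin -aE.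
  have -> : path_prob (step_prob e) t i (uncovered (A :\ i)) =
      path_prob (step_prob e) t i (fun s => uncovered (A :\ i) (i :: s)) :> R.
    apply: eq_path_prob => s; congr negb; apply/fintype.subsetP/fintype.subsetP => H z zA.
      by rewrite in_cons H ?orbT.
    by have := H z zA; rewrite in_cons; case: eqVneq zA => // ->; rewrite !inE eqxx.
  rewrite -(walk_law (walks_srw W ord0)) le_measure ?inE//.
    exact: (measurable_segment (walks_srw W ord0)).
  move=> omega /= /fintype.subsetPn[v vA vs].
  by exists v => j; rewrite (ord1 j).
have [M LM] : exists M, forall x U, matthews g h x U <= M.
  exists (\sum_x \sum_(U : {set V}) `|matthews g h x U|) => x U.
  rewrite (bigD1 x)//= (bigD1 U)//= -addrA; apply: le_trans (ler_norm _) _.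
  by rewrite lerDl addr_ge0 ?sumr_ge0// => y _; rewrite sumr_ge0.
(* Truncating at [t >= M] makes the remainder at most [t * a t], hence at most the sum of the
   decreasing [a s] over [s < t]. That sum is thus counted twice, whence the division by 2. *)
pose t := Num.bound `|M|.
have Mt : M <= t%:R.
  by apply: le_trans (ler_norm _) _; exact/ltW/archi_boundP/normr_ge0.
have iAi : i \notin A :\ i by rewrite !inE eqxx.
have AiA : A :\ i \subset A by exact: finset.subD1set.
have HM := matthews_le step_prob_ge0 step1 gd gs gf LM t AiA iAi.
have HL := le_trans (matthews_ge g0 h0 i L0) HM.
have sum_pa : \sum_(s < t) path_prob (step_prob e) s i (uncovered (A :\ i)) <= \sum_(0 <= s < t) a s.
  by rewrite big_mkord; apply: ler_sum => s _.
have Mpa : M * path_prob (step_prob e) t i (uncovered (A :\ i)) <= \sum_(0 <= s < t) a s.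
  apply: (@le_trans _ _ (t%:R * a t)).
    apply: (@le_trans _ _ (t%:R * path_prob (step_prob e) t i (uncovered (A :\ i)))).
      by apply: ler_wpM2r Mt; apply: path_prob_ge0 => // x y; exact: step_prob_ge0.
    by rewrite ler_wpM2l.
  rewrite mulr_natl big_mkord -[X in _ *+ X]card_ord -sumr_const.
  by apply: ler_sum => s _; apply: a_anti; exact: ltnW.
apply: le_trans (integral_cover_time_ge (walks_srw W) t).
under eq_bigr do rewrite aE.
rewrite sumEFin lee_fin; lra.
Qed.

End cover_bounds.

(** * Geometry of the torus *)

Section torus.
Variable m : nat.
Hypothesis m_gt2 : (2 < m)%N.

Lemma val_ordS (a : 'I_m) : ordS a = (if a.+1 == m then 0 else a.+1)%N :> nat.
Proof.
rewrite /=; case: eqP => [->|]; first by rewrite modnn.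
by move=> ?; rewrite modn_small//; have := ltn_ord a; lia.
Qed.

Lemma val_ord_pred (a : 'I_m) : ord_pred a = (if a == 0 :> nat then m.-1 else a.-1)%N :> nat.
Proof.
rewrite /=; case: eqP => [->|a0]; first by rewrite modn_small; lia.
have am := ltn_ord a.
by rewrite (_ : (a + m).-1 = a.-1 + m)%N ?modnDr ?modn_small; lia.
Qed.

Lemma cycle_adjE (a b : 'I_m) : cycle_adj a b = (b == ordS a) || (b == ord_pred a).
Proof.
have E : (a == ordS b) = (b == ord_pred a).
  by apply/eqP/eqP => [->|->]; rewrite ?ordSK ?ord_predK.
rewrite /cycle_adj E andb_idl// => /orP[] /eqP ->.
  by rewrite -val_eqE [val (ordS a)]val_ordS /=; have := ltn_ord a; case: ifP; lia.
by rewrite -val_eqE [val (ord_pred a)]val_ord_pred /=; have := ltn_ord a; case: ifP; lia.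
Qed.

Definition torus_neighbors (x : 'I_m * 'I_m) : seq ('I_m * 'I_m) :=
  [:: (ordS x.1, x.2); (ord_pred x.1, x.2); (x.1, ordS x.2); (x.1, ord_pred x.2)].

Lemma torus_adjE x y : torus_adj x y = (y \in torus_neighbors x).
Proof.
case: x y => [a b] [a' b']; rewrite /torus_adj !cycle_adjE !inE !xpair_eqE /=.
rewrite [b == b']eq_sym [a == a']eq_sym.
by rewrite andb_orl andb_orr -!orbA.
Qed.

(** Gives every vertex degree 4. For [m <= 2] the successor and the predecessor on the cycle
    coincide. *)
Lemma uniq_torus_neighbors x : uniq (torus_neighbors x).
Proof.
case: x => a b; rewrite /torus_neighbors /= !inE !xpair_eqE -!val_eqE.
rewrite ![val (ordS _)]val_ordS ![val (ord_pred _)]val_ord_pred.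
have := ltn_ord a; have := ltn_ord b.
by rewrite /=; repeat (case: ifP => ?); lia.
Qed.

Lemma torus_step_sum (R : realType) (f : 'I_m * 'I_m -> R) x :
  \sum_y step_prob (@torus_adj m) x y * f y =
  (f (ordS x.1, x.2) + f (ord_pred x.1, x.2) +
   f (x.1, ordS x.2) + f (x.1, ord_pred x.2)) / 4.
Proof.
have card4 : #|[pred u | torus_adj x u]| = 4.
  rewrite (eq_card (B := mem (torus_neighbors x))); first exact/card_uniqP/uniq_torus_neighbors.
  by move=> y; rewrite [LHS]inE /= torus_adjE.
rewrite (eq_bigr (fun y => if y \in torus_neighbors x then f y / 4 else 0)).
  rewrite -big_mkcond -big_uniq ?uniq_torus_neighbors//=.
  by rewrite !big_cons big_nil /=; field.
move=> y _; rewrite /step_prob card4 torus_adjE.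
by case: ifP => _; rewrite ?mul0r// mulrC.
Qed.

Lemma torus_step_sum1 (R : realType) x :
  \sum_y step_prob (@torus_adj m) x y = 1 :> R.
Proof.
have := torus_step_sum (fun=> 1 : R) x.
under eq_bigr do rewrite mulr1.
by move=> ->; field.
Qed.

(** With truncated subtraction one summand of [x] vanishes, so [x] is the absolute difference of the
    representatives. *)
Definition cycle_dist (a b : 'I_m) : nat :=
  let x := (a - b + (b - a))%N in minn x (m - x).

(** Trades the minimum for linear equations, one per direction with or without wraparound, fit for
    linear arithmetic. *)
Lemma cycle_distP (a b : 'I_m) :
  ((cycle_dist a b).*2 <= m)%N /\
  [\/ b = a + cycle_dist a b :> nat, a = b + cycle_dist a b :> nat,
      b + m = a + cycle_dist a b | a + m = b + cycle_dist a b]%N.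
Proof.
have := ltn_ord a; have := ltn_ord b; rewrite /cycle_dist.
set x := (a - b + (b - a))%N => bm am.
have xm : (x < m)%N by rewrite /x; lia.
case: (leqP (a : nat) b) => ab.
  have -> : x = (b - a)%N by rewrite /x; lia.
  case: (leqP (b - a) (m - (b - a))) => H; split; first by lia.
  - by apply: Or41; lia.
  - by lia.
  - by apply: Or44; lia.
have -> : x = (a - b)%N by rewrite /x; lia.
case: (leqP (a - b) (m - (a - b))) => H; split; first by lia.
- by apply: Or42; lia.
- by lia.
- by apply: Or43; lia.
Qed.

(* [p] is the neighbour of [b] towards [a], [q] the one away from [a], which
   fails to be further away only when [b] is antipodal to [a]. *)
Lemma cycle_dist_step (a b : 'I_m) : exists p q : nat,
  [/\ (cycle_dist a (ordS b) = p /\ cycle_dist a (ord_pred b) = q) \/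
      (cycle_dist a (ordS b) = q /\ cycle_dist a (ord_pred b) = p),
      (if cycle_dist a b is d.+1 then p = d else p = 1)%N,
      (cycle_dist a b <= q.+1)%N, (q <= (cycle_dist a b).+1)%N
    & ((cycle_dist a b).+1.*2 <= m -> q = (cycle_dist a b).+1)%N].
Proof.
have := ltn_ord a; have := ltn_ord b.
have := val_ordS b; have := val_ord_pred b.
have := cycle_distP a b; have := cycle_distP a (ordS b); have := cycle_distP a (ord_pred b).
move: (nat_of_ord (ordS b)) (nat_of_ord (ord_pred b)) => s p.
move: (cycle_dist a (ordS b)) (cycle_dist a (ord_pred b)) (cycle_dist a b) => u v d.
move: (nat_of_ord a) (nat_of_ord b) => {}a {}b Hv Hu Hd Hp Hs bm am.
have {}Hp : (b = 0 /\ p + 1 = m \/ b = p + 1)%N by move: Hp; case: eqP; lia.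
have {}Hs : (b + 1 = m /\ s = 0 \/ s = b + 1)%N by move: Hs; case: eqP; lia.
case: Hv => v2 Hv; case: Hu => u2 Hu; case: Hd => d2 Hd.
have [ud ud'] : (u <= d.+1 /\ d <= u.+1)%N.
  by clear Hv Hp; case: Hs => Hs; case: Hu => Hu; case: Hd => Hd; lia.
have [vd vd'] : (v <= d.+1 /\ d <= v.+1)%N.
  by clear Hu Hs; case: Hp => Hp; case: Hv => Hv; case: Hd => Hd; lia.
have uvd : (d = 0 /\ u = 1 /\ v = 1 \/ (0 < d /\ (u.+1 = d \/ v.+1 = d)))%N.
  by case: Hs => Hs; case: Hp => Hp; case: Hu => Hu; case: Hv => Hv; case: Hd => Hd; lia.
have far : (d.+1.*2 <= m -> u = d.+1 \/ v = d.+1)%N.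
  by case: Hs => Hs; case: Hp => Hp; case: Hu => Hu; case: Hv => Hv; case: Hd => Hd; lia.
clear Hs Hp Hu Hv Hd.
case: d uvd ud vd ud' vd' far {d2} => [|d] uvd ud vd ud' vd' far.
  by exists 1%N, 1%N; split => //=; lia.
have [ud1|ud1] := eqVneq u d.
  by exists u, v; split => //=; lia.
by exists v, u; split => //=; lia.
Qed.

Lemma cycle_dist_le (a b : 'I_m) : ((cycle_dist a b).*2 <= m)%N.
Proof. by case: (cycle_distP a b). Qed.

Lemma cycle_distxx (a : 'I_m) : cycle_dist a a = 0%N.
Proof. by rewrite /cycle_dist; lia. Qed.

Lemma cycle_dist_eq0 (a b : 'I_m) : (cycle_dist a b == 0%N) = (a == b).
Proof.
by rewrite /cycle_dist -val_eqE /=; have := ltn_ord a; have := ltn_ord b; lia.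
Qed.

Lemma cycle_antipode (a : 'I_m) : exists b : 'I_m, cycle_dist a b = (m./2)%N.
Proof.
have am := ltn_ord a.
have bm : ((if a + m./2 < m then a + m./2 else a - (m - m./2)) < m)%N.
  by case: ifP; lia.
by exists (Ordinal bm); rewrite /cycle_dist /=; case: ifP; lia.
Qed.

Definition torus_sqdist (u v : 'I_m * 'I_m) : nat :=
  (cycle_dist u.1 v.1 ^ 2 + cycle_dist u.2 v.2 ^ 2)%N.

Lemma torus_sqdistxx u : torus_sqdist u u = 0%N.
Proof. by rewrite /torus_sqdist !cycle_distxx. Qed.

Lemma torus_sqdist_gt0 u v : v != u -> (0 < torus_sqdist u v)%N.
Proof.
apply: contraNT; rewrite -leqNgt leqn0 addn_eq0 !expn_eq0 !andbT !cycle_dist_eq0.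
by case: u v => ? ? [? ?] /=; rewrite xpair_eqE eq_sym [_ == _ as X in _ && X]eq_sym.
Qed.

Lemma torus_sqdist_le u v : ((torus_sqdist u v).*2 <= m ^ 2)%N.
Proof.
have := cycle_dist_le u.1 v.1; have := cycle_dist_le u.2 v.2.
by rewrite /torus_sqdist; nia.
Qed.

(** Reduces one-step means to pairs of naturals: in each coordinate [p] is the move towards [u] and
    [q] the move away, so the drift inequalities need no modular arithmetic. *)
Lemma torus_step_sqdist (R : realType) (f : nat -> R) (u x : 'I_m * 'I_m) :
  exists p1 q1 p2 q2 : nat,
  let d1 := cycle_dist u.1 x.1 in let d2 := cycle_dist u.2 x.2 in
  [/\ (if d1 is d.+1 then p1 = d else p1 = 1)%N,
      (if d2 is d.+1 then p2 = d else p2 = 1)%N,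
      [/\ (d1 <= q1.+1)%N, (q1 <= d1.+1)%N & (d1.+1.*2 <= m -> q1 = d1.+1)%N],
      [/\ (d2 <= q2.+1)%N, (q2 <= d2.+1)%N & (d2.+1.*2 <= m -> q2 = d2.+1)%N]
    & \sum_y step_prob (@torus_adj m) x y * f (torus_sqdist u y) =
      (f (p1 ^ 2 + d2 ^ 2)%N + f (q1 ^ 2 + d2 ^ 2)%N +
       f (d1 ^ 2 + p2 ^ 2)%N + f (d1 ^ 2 + q2 ^ 2)%N) / 4].
Proof.
have [p1 [q1 [h1 hp1 hq1 hq1' hq1'']]] := cycle_dist_step u.1 x.1.
have [p2 [q2 [h2 hp2 hq2 hq2' hq2'']]] := cycle_dist_step u.2 x.2.
exists p1, q1, p2, q2; split => //.
rewrite (torus_step_sum (fun y => f (torus_sqdist u y))) /torus_sqdist /=.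
by case: h1 => -[-> ->]; case: h2 => -[-> ->]; congr (_ / _); ring.
Qed.

(** Takes the points [(a * s, 0)] with [a < s]; [s ^ 2 <= m] leaves a gap of at least [s] across the
    wraparound too. *)
Lemma torus_separated (s : nat) : (0 < s)%N -> (s ^ 2 <= m)%N ->
  exists A : {set 'I_m * 'I_m}, #|A| = s /\
    forall u v, u \in A -> v \in A -> u != v -> (s ^ 2 <= torus_sqdist v u)%N.
Proof.
move=> s0 sm.
have bound (a : 'I_s) : (a * s < m)%N by have := ltn_ord a; nia.
have m0 : (0 < m)%N by lia.
pose f (a : 'I_s) : 'I_m * 'I_m := (Ordinal (bound a), Ordinal m0).
exists [set f a | a : 'I_s]; split.
  rewrite card_imset ?card_ord// => a b [] /eqP ab.
  by apply/val_inj/eqP; move: ab; rewrite eqn_pmul2r.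
move=> u v /imsetP[a _ ->] /imsetP[b _ ->] ab.
have {ab} : (a != b :> nat) by apply: contraNneq ab => /val_inj ->.
move=> ab; rewrite /torus_sqdist /= cycle_distxx.
have H : (s <= cycle_dist (Ordinal (bound b)) (Ordinal (bound a)))%N.
  have lt_mul (c c' : nat) : (c < c')%N -> (c * s + s <= c' * s)%N.
    by move=> cc'; rewrite addnC -mulSn leq_mul2r cc' orbT.
  have := lt_mul _ _ (ltn_ord a); have := lt_mul _ _ (ltn_ord b).
  rewrite mulnn /cycle_dist /=.
  by move: ab; rewrite neq_ltn => /orP[] /lt_mul; lia.
by rewrite addn0 leq_exp2r.
Qed.

End torus.

(** * Drift inequalities *)

Section logarithm.
Context {R : realType}.
Implicit Types x y s : R.

Lemma ln_le_sub1 x : 0 < x -> ln x <= x - 1.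
Proof.
move=> x0; have := @le_ln1Dx R (x - 1).
have -> : 1 + (x - 1) = x by ring.
by apply; lra.
Qed.

Lemma ln_ge_1subV x : 0 < x -> 1 - x^-1 <= ln x.
Proof.
move=> x0; have := @ln_le_sub1 x^-1; rewrite invr_gt0 lnV ?posrE// => /(_ x0).
by lra.
Qed.

Lemma ln_le x y : 0 < x -> x <= y -> ln x <= ln y.
Proof. by move=> x0 xy; rewrite ler_ln ?posrE//; exact: lt_le_trans xy. Qed.

(** With [ln_expr4], turns sub- or superharmonicity of a logarithm into a polynomial inequality. *)
Lemma ln_mul4 x1 x2 x3 x4 : 0 < x1 -> 0 < x2 -> 0 < x3 -> 0 < x4 ->
  ln x1 + ln x2 + ln x3 + ln x4 = ln (x1 * x2 * (x3 * x4)).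
Proof. by move=> *; rewrite !lnM ?posrE ?mulr_gt0// addrA. Qed.

Lemma ln_expr4 s : 0 < s -> 4 * ln s = ln (s ^+ 4).
Proof. by move=> s0; rewrite lnXn// mulr_natl. Qed.

End logarithm.

(** * Upper bound for hitting times *)

Section hitting_upper.
Context {R : realType}.
Variable n : R.
Hypothesis n1 : 1 <= n.

(* [ln (r - 1/2)], with [r] the squared distance to the origin, is
   superharmonic on [Z^2] away from the origin; [126] is the least normalization
   for which the value [0] at the origin keeps it so at distance [1]. *)
Definition hit_upper (r : nat) : R :=
  if r == 0%N then 0 else n * ln (126 * (r%:R - 2^-1)) - r%:R.

(** [n * ln (r - 1/2) - r] increases while [r <= n], in discrete form by [ln (b / a) >= 1 - a / b].
    This allows an outer neighbour that wraps around to be replaced by the farther one in the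
    plane. *)
Lemma hit_upper_mono (r s : nat) : (r <= s)%N -> s%:R <= n -> hit_upper r <= hit_upper s.
Proof.
move=> rs sn; rewrite /hit_upper.
have ln4 : 1 <= ln 4 :> R.
  have -> : 4 = 2 ^+ 2 :> R by ring.
  by rewrite lnXn// mulr2n; have := @ln_ge_1subV R 2 (ltr0Sn _ 1); lra.
case: eqP rs => [_ _|/eqP r0 rs].
  case: eqP => // /eqP; rewrite -lt0n -(ler_nat R) => s1.
  have : 1 <= ln (126 * (s%:R - 2^-1)) :> R by apply: (le_trans ln4); apply: ln_le; lra.
  by nra.
have s0 : (s == 0)%N = false by apply/negbTE; lia.
rewrite s0; move: r0 rs; rewrite -lt0n -(ler_nat R) -(ler_nat R r) => r1 rs.
set a := r%:R - 2^-1; set b := s%:R - 2^-1.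
have a0 : 0 < a by rewrite /a; lra.
have ab : a <= b by rewrite /a /b; lra.
have b0 : 0 < b by lra.
have bn : b <= n by rewrite /b; lra.
have := @ln_ge_1subV R (b / a); rewrite divr_gt0// => /(_ isT).
rewrite ln_div ?posrE// invf_div => H.
rewrite !lnM ?posrE//.
have : (b - a) / b <= ln b - ln a by rewrite mulrBl divff ?gt_eqF.
rewrite ler_pdivrMr// => {}H.
have : b - a <= n * (ln b - ln a) by apply: (le_trans H); rewrite mulrC ler_wpM2r//; nra.
by rewrite /a /b; lra.
Qed.

(** The computation in the plane. The squared distances of the four neighbours sum to [4 * r + 4],
    whence the [- 4]. For the logarithms, the shift by [1/2] makes [(r - 1/2) ^ 4] exceed the
    product over the neighbours by the square of [2 * (a ^ 2 - b ^ 2)]. *)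
Lemma hit_upper_free (a b p q : nat) :
  (0 < a ^ 2 + b ^ 2)%N ->
  (if a is a'.+1 then p = a' else p = 1)%N ->
  (if b is b'.+1 then q = b' else q = 1)%N ->
  hit_upper (p ^ 2 + b ^ 2) + hit_upper (a.+1 ^ 2 + b ^ 2) +
  hit_upper (a ^ 2 + q ^ 2) + hit_upper (a ^ 2 + b.+1 ^ 2) <=
  4 * hit_upper (a ^ 2 + b ^ 2) - 4.
Proof.
move=> r0 hp hq.
have [r1|r2] := leqP (a ^ 2 + b ^ 2) 1.
  have ab : (a = 1 /\ b = 0 \/ a = 0 /\ b = 1)%N by move: r0 r1; nia.
  (* The neighbour at the origin contributes 0, and the comparison is between [441 * 189 * 189] and
     [63 ^ 4], which are equal. *)
  have E : ln (126 * (4 - 2^-1)) + 2 * ln (126 * (2 - 2^-1)) <= 4 * ln (126 * (1 - 2^-1)) :> R.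
    have := @ln_mul4 R (126 * (4 - 2^-1)) (126 * (2 - 2^-1)) (126 * (2 - 2^-1)) 1.
    rewrite ln1 ln_expr4; last by lra.
    move=> H; rewrite [leRHS](_ : _ = ln (126 * (4 - 2^-1) * (126 * (2 - 2^-1)) * (126 * (2 - 2^-1) * 1))).
      by rewrite -H; lra.
    by congr ln; lra.
  have nE := ler_wpM2l (le_trans ler01 n1) E.
  by case: ab => -[a1 b0]; subst a b; subst p q; rewrite /hit_upper /=; lra.
(* When [a = 0], the neighbour [p = 1] stands for [-1], so the formula is uniform. *)
have pE : (p ^ 2)%:R = (a%:R - 1) ^+ 2 :> R.
  by case: a hp {r0 r2} => [|a] -> ; rewrite natrX ?sub0r ?sqrrN// -natr1 addrK.
have qE : (q ^ 2)%:R = (b%:R - 1) ^+ 2 :> R.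
  by case: b hq {r0 r2} => [|b] -> ; rewrite natrX ?sub0r ?sqrrN// -natr1 addrK.
have p0 : (p ^ 2 + b ^ 2 == 0)%N = false.
  by apply/negbTE; case: a hp r2 {r0 pE} => [|a] ->; nia.
have q0 : (a ^ 2 + q ^ 2 == 0)%N = false.
  by apply/negbTE; case: b hq r2 {r0 qE p0} => [|b] ->; nia.
have a0 : (a.+1 ^ 2 + b ^ 2 == 0)%N = false by apply/negbTE; nia.
have b0 : (a ^ 2 + b.+1 ^ 2 == 0)%N = false by apply/negbTE; nia.
have r0' : (a ^ 2 + b ^ 2 == 0)%N = false by apply/negbTE; lia.
rewrite /hit_upper p0 q0 a0 b0 r0'.
have {}p0 : 1 <= (p ^ 2 + b ^ 2)%:R :> R by rewrite ler1n lt0n p0.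
have {}q0 : 1 <= (a ^ 2 + q ^ 2)%:R :> R by rewrite ler1n lt0n q0.
have {}a0 : 1 <= (a.+1 ^ 2 + b ^ 2)%:R :> R by rewrite ler1n lt0n a0.
have {}b0 : 1 <= (a ^ 2 + b.+1 ^ 2)%:R :> R by rewrite ler1n lt0n b0.
have {}r0 : 1 <= (a ^ 2 + b ^ 2)%:R :> R by rewrite ler1n lt0n r0'.
move: p0 q0 a0 b0 r0; rewrite !natrD pE qE !natrX -!(natr1 a) -!(natr1 b).
move: (a%:R) (b%:R) => {pE qE hp hq r2 r0' p q a b} a b p0 q0 a0 b0 r0.
set L := ln _; set L2 := ln _; set L3 := ln _; set L4 := ln _; set L0 := ln _.
suff : L + L2 + L3 + L4 <= 4 * L0.
  by move=> H; have := ler_wpM2l (le_trans ler01 n1) H; nra.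
rewrite ln_mul4 ?ln_expr4; try by lra.
apply: ln_le; first by rewrite !mulr_gt0//; lra.
rewrite -subr_ge0.
have -> : (126 * (a ^+ 2 + b ^+ 2 - 2^-1)) ^+ 4 - 126 * ((a - 1) ^+ 2 + b ^+ 2 - 2^-1) * (126 * ((a + 1) ^+ 2 + b ^+ 2 - 2^-1)) *
   (126 * (a ^+ 2 + (b - 1) ^+ 2 - 2^-1) * (126 * (a ^+ 2 + (b + 1) ^+ 2 - 2^-1))) =
   126 ^+ 4 * (2 * (a ^+ 2 - b ^+ 2)) ^+ 2 by field.
by rewrite mulr_ge0// sqr_ge0.
Qed.

End hitting_upper.

Section torus_upper.
Context {R : realType}.
Variable m : nat.
Hypothesis m_gt2 : (2 < m)%N.
Variable n : R.
Hypothesis nE : n = (m ^ 2)%:R.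

Lemma torus_size_ge1 : 1 <= n. Proof. by rewrite nE ler1n; nia. Qed.

Lemma torus_hit_upper_bound (v x : 'I_m * 'I_m) :
  0 <= hit_upper n (torus_sqdist v x) <= n * ln (126 * n).
Proof.
have n1 := torus_size_ge1.
have dn : (torus_sqdist v x)%:R <= n.
  by rewrite nE ler_nat; have := torus_sqdist_le m_gt2 v x; lia.
apply/andP; split.
  by rewrite -[X in X <= _]/(hit_upper n 0); apply: hit_upper_mono.
rewrite /hit_upper; case: eqP => [_|/eqP].
  by rewrite mulr_ge0 ?ln_ge0//; lra.
rewrite -lt0n -(ler_nat R) => d1.
have : ln (126 * ((torus_sqdist v x)%:R - 2^-1)) <= ln (126 * n) by apply: ln_le; lra.
by move=> /(ler_wpM2l (le_trans ler01 n1)); lra.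
Qed.

(** Wrapping only brings an outer neighbour closer, so by monotonicity the planar values dominate;
    [a, b <= m / 2] keeps the squared distances within [n]. *)
Lemma torus_hit_upper_step (v x : 'I_m * 'I_m) : x != v ->
  \sum_y step_prob (@torus_adj m) x y * hit_upper n (torus_sqdist v y) <=
  hit_upper n (torus_sqdist v x) - 1.
Proof.
move=> xv; have n1 := torus_size_ge1.
have [p1 [q1 [p2 [q2 [hp1 hp2 [_ hq1 _] [_ hq2 _] ->]]]]] :=
  torus_step_sqdist m_gt2 (hit_upper n) v x.
have := torus_sqdist_gt0 m_gt2 xv.
have := cycle_dist_le m_gt2 v.1 x.1; have := cycle_dist_le m_gt2 v.2 x.2.
rewrite /torus_sqdist; move: (cycle_dist v.1 x.1) (cycle_dist v.2 x.2) hp1 hp2 hq1 hq2.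
move=> a b hp1 hp2 hq1 hq2 bm am r0.
have := hit_upper_free n1 r0 hp1 hp2.
have A : hit_upper n (q1 ^ 2 + b ^ 2) <= hit_upper n (a.+1 ^ 2 + b ^ 2).
  by apply: hit_upper_mono => //; [nia|rewrite nE ler_nat; nia].
have B : hit_upper n (a ^ 2 + q2 ^ 2) <= hit_upper n (a ^ 2 + b.+1 ^ 2).
  by apply: hit_upper_mono => //; [nia|rewrite nE ler_nat; nia].
by lra.
Qed.

End torus_upper.

(** * Lower bound for hitting times *)

Section hitting_lower.
Context {R : realType}.
Variable q : R.
Hypothesis q80 : 80 <= q.

(* [ln s - s / q] is flat at [s = q], so truncating it there costs a drift of
   order [1 / q] only. *)
Definition cap_log (s : R) : R := ln (Num.min s q) - Num.min s q / q.

(** [ln s - s / q] is maximal at [s = q], where the truncation freezes it. *)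
Lemma cap_log_ge s : 0 < s -> ln s - s / q <= cap_log s.
Proof.
move=> s0; have q80' := q80; have q0 : 0 < q by lra.
rewrite /cap_log; case: (leP s q) => // qs.
have := @ln_le_sub1 R (s / q); rewrite divr_gt0// ln_div ?posrE// => /(_ isT).
by rewrite divff ?gt_eqF//; lra.
Qed.

(** From the cap on, only a neighbour falling below [q] loses anything, and the loss is of second
    order: at most [(q - t) ^ 2 / (t * q)], where [q - t <= 2 * d] and [d] is of order [sqrt q]. *)
Lemma cap_log_near (s t d : R) : q <= s -> 1 <= t -> 0 <= d -> d ^+ 2 <= s - 1 ->
  s + 1 - 2 * d <= t -> cap_log s - 10 / q <= cap_log t.
Proof.
move=> qs t1 d0 ds td; have q80' := q80; have q0 : 0 < q by lra.
have iq0 : 0 <= 10 / q by rewrite divr_ge0//; lra.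
rewrite /cap_log (min_idPr qs).
case: (leP q t) => [_|tq]; first by lra.
(* Here [d ^ 2 <= s - 1 < q + 2 * d - 2], and [(d - 10) ^ 2 >= 0] bounds [2 * d] by
   [d ^ 2 / 10 + 10]; [q >= 80] absorbs the constants. *)
have d2 : d ^+ 2 <= 5 / 4 * q by have := sqr_ge0 (d - 10); nra.
have qt : (q - t) ^+ 2 <= 5 * q.
  have : q - t <= 2 * d by lra.
  by nra.
have tq2 : q / 2 <= t by nra.
have t0 : 0 < t by lra.
have := @ln_ge_1subV R (t / q); rewrite divr_gt0// ln_div ?posrE// invf_div => /(_ isT) H.
rewrite divff ?gt_eqF//.
suff : t / q + q / t - 2 <= 10 / q by lra.
have -> : t / q + q / t - 2 = (q - t) ^+ 2 / t / q by field; rewrite !gt_eqF.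
rewrite ler_pM2r ?invr_gt0// ler_pdivrMr//; lra.
Qed.

(** The shift [r + 1] keeps the logarithm finite at the origin, [1 / q] normalizes the value there
    to 0, and [q / 10] scales a loss of [10 / q] per neighbour to 1 per step. *)
Definition hit_lower (r : nat) : R := q / 10 * (cap_log (r%:R + 1) + q^-1).

Lemma hit_lower0 : hit_lower 0 = 0.
Proof.
have q80' := q80.
rewrite /hit_lower /cap_log add0r (min_idPl _); last by lra.
by rewrite ln1 div1r sub0r addNr mulr0.
Qed.

Lemma hit_lower_ge0 r : 0 <= hit_lower r.
Proof.
have q80' := q80; have q0 : 0 < q by lra.
rewrite mulr_ge0//; first by lra.
rewrite /cap_log.
have : 1 <= Num.min (r%:R + 1) q by rewrite le_min lerDr ler0n /=; lra.
have : Num.min (r%:R + 1) q <= q by rewrite ge_min lexx orbT.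
move: (Num.min _ _) => y yq y1; have y0 : 0 < y by lra.
have := ln_ge_1subV y0.
suff : y / q - q^-1 <= 1 - y^-1 by lra.
have -> : y / q - q^-1 = (y - 1) / q by field; rewrite gt_eqF.
have -> : 1 - y^-1 = (y - 1) / y by field; rewrite gt_eqF.
by apply: ler_wpM2l; [lra|rewrite lef_pV2 ?posrE].
Qed.

Lemma hit_lower_ge (r : nat) (y : R) : 1 <= y -> y <= r%:R + 1 -> y <= q ->
  q / 10 * (ln y - 1) <= hit_lower r.
Proof.
move=> y1 yr yq; have q80' := q80; have q0 : 0 < q by lra.
apply: ler_wpM2l; first by lra.
have iq : 0 < q^-1 by rewrite invr_gt0.
rewrite /cap_log.
have : y <= Num.min (r%:R + 1) q by rewrite le_min yr.
have : Num.min (r%:R + 1) q / q <= 1 by rewrite ler_pdivrMr// mul1r ge_min lexx orbT.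
move: (Num.min _ _) => x x1 yx.
have : ln y <= ln x by apply: ln_le; lra.
by lra.
Qed.

(** Below the cap the product over the four neighbours exceeds [s ^ 4], so the logarithm is
    subharmonic and only the linear term loses, [4 / q] in all. From the cap on, each neighbour
    loses at most [10 / q]; there the outer one need only be no closer than the inner one. *)
Lemma hit_lower_step (a b p1 q1 p2 q2 : nat) :
  (if a is a'.+1 then p1 = a' else p1 = 1)%N ->
  (if b is b'.+1 then p2 = b' else p2 = 1)%N ->
  (a <= q1.+1)%N -> (b <= q2.+1)%N -> (a = 0 -> q1 = 1)%N -> (b = 0 -> q2 = 1)%N ->
  ((a ^ 2 + b ^ 2)%:R + 1 < q -> q1 = a.+1 /\ q2 = b.+1) ->
  4 * hit_lower (a ^ 2 + b ^ 2) - 4 <=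
  hit_lower (p1 ^ 2 + b ^ 2) + hit_lower (q1 ^ 2 + b ^ 2) +
  hit_lower (a ^ 2 + p2 ^ 2) + hit_lower (a ^ 2 + q2 ^ 2).
Proof.
move=> hp1 hp2 hq1 hq2 a0 b0 hq; have q80' := q80; have q0 : 0 < q by lra.
pose phi (r : nat) := cap_log (r%:R + 1).
suff : 4 * phi (a ^ 2 + b ^ 2)%N - 40 / q <=
    phi (p1 ^ 2 + b ^ 2)%N + phi (q1 ^ 2 + b ^ 2)%N +
    phi (a ^ 2 + p2 ^ 2)%N + phi (a ^ 2 + q2 ^ 2)%N.
  move=> H; have q10 : 0 <= q / 10 by lra.
  have := ler_wpM2l q10 H.
  rewrite mulrBr; have -> : q / 10 * (40 / q) = 4 by field; rewrite gt_eqF.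
  by rewrite /hit_lower -/(phi _) !mulrDr; lra.
rewrite /phi.
have p1E : (p1 ^ 2)%:R = (a%:R - 1) ^+ 2 :> R.
  by case: a hp1 {hq hq1 a0} => [|a'] -> ; rewrite natrX ?sub0r ?sqrrN// -natr1 addrK.
have p2E : (p2 ^ 2)%:R = (b%:R - 1) ^+ 2 :> R.
  by case: b hp2 {hq hq2 b0} => [|b'] -> ; rewrite natrX ?sub0r ?sqrrN// -natr1 addrK.
have pos (r : nat) : 1 <= r%:R + 1 :> R by rewrite lerDr ler0n.
have [lt|ge] := ltP ((a ^ 2 + b ^ 2)%:R + 1) q.
  have [{}hq1 {}hq2] := hq lt; subst q1 q2.
  have P (r : nat) : ln (r%:R + 1) - (r%:R + 1) / q <= cap_log (r%:R + 1).
    by apply: cap_log_ge; have := pos r; lra.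
  rewrite {1}/cap_log (min_idPl (ltW lt)).
  have := P (p1 ^ 2 + b ^ 2)%N; have := P (a.+1 ^ 2 + b ^ 2)%N.
  have := P (a ^ 2 + p2 ^ 2)%N; have := P (a ^ 2 + b.+1 ^ 2)%N.
  have := pos (p1 ^ 2 + b ^ 2)%N; have := pos (a.+1 ^ 2 + b ^ 2)%N.
  have := pos (a ^ 2 + p2 ^ 2)%N; have := pos (a ^ 2 + b.+1 ^ 2)%N.
  have := pos (a ^ 2 + b ^ 2)%N.
  rewrite !natrD p1E p2E !natrX -(natr1 a) -(natr1 b).
  move: (a%:R) (b%:R) => {hq a0 b0 P lt p1E p2E hp1 hp2 pos phi a b} a b s1 x4 x3 x2 x1.
  have [s sE] : exists s, s = a ^+ 2 + b ^+ 2 + 1 by exists (a ^+ 2 + b ^+ 2 + 1).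
  rewrite -!sE in s1 *.
  have L : ln s *+ 4 <= ln ((a - 1) ^+ 2 + b ^+ 2 + 1) + ln ((a + 1) ^+ 2 + b ^+ 2 + 1) +
      ln (a ^+ 2 + (b - 1) ^+ 2 + 1) + ln (a ^+ 2 + (b + 1) ^+ 2 + 1).
    rewrite -mulr_natl ln_expr4 ?ln_mul4; try by lra.
    apply: ln_le; first by rewrite exprn_gt0; lra.
    rewrite -subr_ge0.
    rewrite [leRHS](_ : _ = 2 * s ^+ 2 + 8 * s + 5 + 16 * (a ^+ 2 * b ^+ 2)); last by rewrite sE; ring.
    have ab0 : 0 <= a ^+ 2 * b ^+ 2 by rewrite mulr_ge0 ?sqr_ge0.
    by have := sqr_ge0 s; lra.
  have S : ((a - 1) ^+ 2 + b ^+ 2 + 1) / q + ((a + 1) ^+ 2 + b ^+ 2 + 1) / q +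
      (a ^+ 2 + (b - 1) ^+ 2 + 1) / q + (a ^+ 2 + (b + 1) ^+ 2 + 1) / q = 4 * (s / q) + 4 / q.
    by rewrite sE; field; rewrite gt_eqF.
  have iq : 0 < q^-1 by rewrite invr_gt0.
  by move: S L; lra.
have near (r d : nat) : ((d ^ 2)%:R <= (a ^ 2 + b ^ 2)%:R :> R) ->
    (a ^ 2 + b ^ 2)%:R + 1 - 2 * d%:R <= r%:R :> R ->
    cap_log ((a ^ 2 + b ^ 2)%:R + 1) - 10 / q <= cap_log (r%:R + 1).
  move=> dr rr; apply: (@cap_log_near _ _ d%:R) => //; rewrite ?ler0n//.
    by rewrite -natrX addrK.
  by lra.
have step (x y : nat) : (x <= y.+1)%N -> (x = 0 -> y = 1)%N ->
    (x ^ 2)%:R + 1 - 2 * x%:R <= (y ^ 2)%:R :> R.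
  move=> xy x0; have : (x ^ 2 + 1 <= y ^ 2 + 2 * x)%N.
    by case: x xy x0 => [|x] xy x0; [rewrite x0|nia].
  by rewrite -(ler_nat R) !natrD natrM; lra.
have s1 := step _ _ hq1 a0; have s2 := step _ _ hq2 b0.
have A : (a ^ 2)%:R <= (a ^ 2 + b ^ 2)%:R :> R by rewrite ler_nat; lia.
have B : (b ^ 2)%:R <= (a ^ 2 + b ^ 2)%:R :> R by rewrite ler_nat; lia.
have := near (p1 ^ 2 + b ^ 2)%N a A; have := near (q1 ^ 2 + b ^ 2)%N a A.
have := near (a ^ 2 + p2 ^ 2)%N b B; have := near (a ^ 2 + q2 ^ 2)%N b B.
have p1E' : (p1 ^ 2)%:R = (a ^ 2)%:R + 1 - 2 * a%:R :> R by rewrite p1E natrX; ring.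
have p2E' : (p2 ^ 2)%:R = (b ^ 2)%:R + 1 - 2 * b%:R :> R by rewrite p2E natrX; ring.
rewrite !natrD p1E' p2E'.
move=> /(_ ltac:(lra)) H1 /(_ ltac:(lra)) H2 /(_ ltac:(lra)) H3 /(_ ltac:(lra)) H4.
lra.
Qed.

End hitting_lower.

(** With the cap at [m ^ 2 / 16], points below it are within [m / 4] of [v] in each coordinate, so
    wraparound occurs only in the capped regime, which tolerates it. *)
Lemma torus_hit_lower_step (R : realType) (m : nat) (q : R) (v x : 'I_m * 'I_m) :
  80 <= q -> q = (m ^ 2)%:R / 16 ->
  hit_lower q (torus_sqdist v x) - 1 <=
  \sum_y step_prob (@torus_adj m) x y * hit_lower q (torus_sqdist v y).
Proof.
move=> q80 qE.
have m2 : (2 < m)%N.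
  have : (1280 <= m ^ 2)%N by rewrite -(ler_nat R); lra.
  by nia.
have [p1 [q1 [p2 [q2 [hp1 hp2 [hq1 _ hq1'] [hq2 _ hq2'] ->]]]]] :=
  torus_step_sqdist m2 (hit_lower q) v x.
rewrite {1}/torus_sqdist; move: (cycle_dist v.1 x.1) (cycle_dist v.2 x.2) hp1 hp2 hq1 hq2 hq1' hq2'.
move=> a b hp1 hp2 hq1 hq2 hq1' hq2'.
suff : 4 * hit_lower q (a ^ 2 + b ^ 2)%N - 4 <=
  hit_lower q (p1 ^ 2 + b ^ 2) + hit_lower q (q1 ^ 2 + b ^ 2) +
  hit_lower q (a ^ 2 + p2 ^ 2) + hit_lower q (a ^ 2 + q2 ^ 2) by lra.
apply: hit_lower_step => //.
- by move=> a0; rewrite hq1' a0//; lia.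
- by move=> b0; rewrite hq2' b0//; lia.
rewrite qE => H.
have {}H : ((a ^ 2 + b ^ 2).+1 * 16 <= m ^ 2)%N.
  by rewrite -(ler_nat R) natrM -natr1; lra.
by split; [apply: hq1'|apply: hq2']; nia.
Qed.

(** From [1/2] on, [x <= 2 * x ^ 2] suffices. Below, [exp y <= 1 / (1 - y)] bounds the left side by
    [2 / (1 - x ^ 2)], at most [2 * (1 + 2 * x ^ 2)] there. *)
Lemma expR_addN_le (R : realType) (x : R) : 0 <= x ->
  expR x + expR (- x) <= 2 * expR (2 * x ^+ 2).
Proof.
move=> x0.
have [x1|x1] := leP (1 / 2) x.
  have : expR (- x) <= expR x by rewrite ler_expR; lra.
  have : expR x <= expR (2 * x ^+ 2) by rewrite ler_expR; nra.
  lra.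
have expR_le (y : R) : y < 1 -> expR y <= (1 - y)^-1.
  move=> y1; have := expR_ge1Dx (- y); rewrite expRN => H.
  by rewrite -[expR y]invrK lef_pV2 ?posrE ?invr_gt0 ?expR_gt0//; lra.
have := expR_le x; have := expR_le (- x).
move=> /(_ ltac:(lra)) H1 /(_ ltac:(lra)) H2.
apply: (@le_trans _ _ (2 * (1 + 2 * x ^+ 2))); last first.
  by rewrite ler_pM2l ?ltr0n//; exact: expR_ge1Dx.
apply: (le_trans (lerD H2 H1)).
have p1 : 1 - x != 0 by rewrite gt_eqF//; lra.
have p3 : 1 + x != 0 by rewrite gt_eqF//; lra.
have p2 : 1 - - x != 0 by rewrite gt_eqF//; lra.
rewrite -subr_ge0.
have -> : 2 * (1 + 2 * x ^+ 2) - ((1 - x)^-1 + (1 - - x)^-1) =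
    2 * x ^+ 2 * (1 - 2 * x ^+ 2) / ((1 - x) * (1 - - x)).
  by field; rewrite ?p1 ?p2 ?p3.
by rewrite divr_ge0 ?mulr_ge0//; nra.
Qed.

(** * Visits to distant vertices *)

Section visits.
Context {R : realType}.
Variable E : R.
Hypothesis E1 : 1 <= E.

(** With [E = exp lambda] this is [cosh (lambda * d)]. *)
Definition cosh_pow (d : nat) : R := (E ^+ d + E ^- d) / 2.

Lemma cosh_pow_mono (a b : nat) : (a <= b)%N -> cosh_pow a <= cosh_pow b.
Proof.
move=> ab; have E1' := E1; rewrite /cosh_pow.
have a1 : 1 <= E ^+ a by rewrite exprn_ege1.
have abE : E ^+ a <= E ^+ b by rewrite ler_weXn2l.
move: (E ^+ a) (E ^+ b) a1 abE => u t u1 ut.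
suff : 0 <= t + t^-1 - (u + u^-1) by lra.
have -> : t + t^-1 - (u + u^-1) = (t - u) * (t * u - 1) / (t * u).
  by field; rewrite !gt_eqF//; lra.
by rewrite divr_ge0 ?mulr_ge0//; nra.
Qed.

(** The addition formula for [cosh]. At [d = 0] evenness lets [p = 1] stand for [-1]; monotonicity
    handles a wrapped [q]. *)
Lemma cosh_pow_step (d p q : nat) : (if d is d'.+1 then p = d' else p = 1)%N ->
  (q <= d.+1)%N -> cosh_pow p + cosh_pow q <= (E + E^-1) * cosh_pow d.
Proof.
move=> hp hq; have E1' := E1; have E0 : E != 0 by rewrite gt_eqF//; lra.
have := cosh_pow_mono hq.
suff -> : (E + E^-1) * cosh_pow d = cosh_pow p + cosh_pow d.+1 by lra.
case: d hp {hq} => [|d] ->; rewrite /cosh_pow.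
  by rewrite expr1 expr0 invr1; field.
rewrite !exprS; field.
by rewrite E0 expf_neq0.
Qed.

(** Vertical moves keep the horizontal distance; their factor 1 is at most the factor
    [(E + 1 / E) / 2] of the horizontal ones. *)
Lemma torus_visit_step (m : nat) (u x : 'I_m * 'I_m) : (2 < m)%N ->
  \sum_y step_prob (@torus_adj m) x y * cosh_pow (cycle_dist u.1 y.1) <=
  (E + E^-1) / 2 * cosh_pow (cycle_dist u.1 x.1).
Proof.
move=> m2; have E1' := E1.
rewrite (torus_step_sum m2 (fun y => cosh_pow (cycle_dist u.1 y.1))) /=.
have [p [q [h hp _ hq _]]] := cycle_dist_step m2 u.1 x.1.
have := cosh_pow_step hp hq.
have c0 : 0 <= cosh_pow (cycle_dist u.1 x.1).
  by rewrite divr_ge0// addr_ge0 ?invr_ge0 ?exprn_ge0//; lra.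
have : 2 <= E + E^-1.
  have := @cosh_pow_mono 0 1 isT; rewrite /cosh_pow expr0 expr1 invr1; lra.
by case: h => -[-> ->]; nra.
Qed.

End visits.

(** * Cover times of the torus *)

Section estimates.
Context {R : realType}.

Lemma le_harmonic_sum (a b : nat) : (a <= b)%N -> harmonic_sum a <= harmonic_sum b :> R.
Proof.
move=> /subnKC <-; rewrite /harmonic_sum big_split_ord /= lerDl.
by apply: sumr_ge0 => j _; rewrite invr_ge0.
Qed.

Lemma ln_le_harmonic_sum (a : nat) : ln a.+1%:R <= harmonic_sum a :> R.
Proof.
elim: a => [|a IH]; first by rewrite ln1 /harmonic_sum big_ord0.
rewrite /harmonic_sum big_ord_recr /= -/(harmonic_sum a); move: IH.
have a0 : 0 < a.+1%:R :> R by rewrite ltr0n.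
have b0 : 0 < a.+2%:R :> R by rewrite ltr0n.
have := @ln_le_sub1 R (a.+2%:R / a.+1%:R); rewrite divr_gt0// ln_div ?posrE// => /(_ isT).
have -> : a.+2%:R / a.+1%:R - 1 = a.+1%:R^-1 :> R.
  by rewrite -(natr1 a.+1) mulrDl mul1r divff ?gt_eqF//; ring.
by move: (a.+1%:R^-1) (ln a.+2%:R) (ln a.+1%:R) => ? ? ?; lra.
Qed.

Lemma torus_cover_le (m k : nat) (i : 'I_m * 'I_m) (W : walks R (@torus_adj m) k i) :
  (12 <= m)%N -> (1 <= k)%N -> k%:R <= ln ((m ^ 2)%:R : R) ->
  (expected_cover_time W <= (16 * (m ^ 2)%:R * ln (m ^ 2)%:R ^+ 2 / k%:R)%:E)%E.
Proof.
move=> m12 k1.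
have m2 : (2 < m)%N by lia.
have n126 : 126 <= (m ^ 2)%:R :> R.
  have m12R : 12 <= m%:R :> R by rewrite ler_nat.
  by rewrite natrX; nra.
have [n nE] : exists n : R, n = (m ^ 2)%:R by eexists.
rewrite -nE in n126 * => kln.
have k1R : 1 <= k%:R :> R by rewrite ler1n.
have := @expected_cover_time_le R _ _ (torus_step_sum1 m2 R) k i W (n * ln (126 * n))
  (fun v x => hit_upper n (torus_sqdist v x)) k1.
have n0 : 0 < n by lra.
have ln1n : 1 <= ln n by exact: le_trans kln.
have h1 : 1 <= n * ln (126 * n).
  have : ln n <= ln (126 * n) by apply: ln_le; lra.
  by move: (ln (126 * n)) => l; nra.
move=> /(_ h1 (torus_hit_upper_bound m2 nE) (torus_hit_upper_step m2 nE)).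
move=> H; apply: (le_trans H); rewrite lee_fin.
rewrite card_prod card_ord mulnn -nE {H nE W}.
(* The constant 126 costs a factor 2, as [n >= 126]. With the 2 of [expected_cover_time_le] and
   [3 + L / K <= 4 * (L / K)], this makes 16. *)
have lnn : ln (126 * n) <= 2 * ln n.
  by rewrite lnM ?posrE//; have := @ln_le R 126 n (ltr0Sn _ _) n126; lra.
move: (k%:R) (ln n) (ln (126 * n)) k1R kln ln1n lnn h1 => K L L' K1 KL L1 LL h1.
have K0 : 0 < K by lra.
have LK : 1 <= L / K by rewrite ler_pdivlMr// mul1r.
have -> : 16 * n * L ^+ 2 / K = 2 * (n * (2 * L)) * (4 * (L / K)) by field; rewrite gt_eqF.
apply: ler_pM; [lra|lra| |lra].
by rewrite ler_pM2l// ler_pM2l.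
Qed.

(** [n <= (2 * s) ^ 4] gives [ln s >= ln n / 4 - 1], and [ln n >= 16] absorbs the constants into the
    factor [1/8]. *)
Lemma hit_lower_matthews_bound (n s : R) : 16 * 80 <= n -> 16 <= ln n -> 1 <= s ->
  n <= (2 * s) ^+ 4 ->
  [/\ n * ln n / (160 * 8) <= n / 16 / 10 * (ln (s ^+ 2 + 1) - 1) &
      ln n / 8 <= ln s - 1].
Proof.
move=> n80 ln16 s1 ns; have s0 : 0 < s by lra.
have lns : ln n / 4 - 1 <= ln s.
  have : ln n <= ln ((2 * s) ^+ 4) by apply: ln_le => //; lra.
  rewrite -ln_expr4 ?lnM ?posrE ?mulr_gt0//.
  by have := @ln_le_sub1 R 2 (ltr0Sn _ 1); lra.
have lns2 : 2 * ln s <= ln (s ^+ 2 + 1).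
  have -> : 2 * ln s = ln (s ^+ 2) by rewrite lnXn// mulr2n; lra.
  by apply: ln_le; rewrite ?exprn_gt0// lerDl.
move: (ln n) (ln s) (ln (s ^+ 2 + 1)) ln16 lns lns2 => L l l' L16 lL ll'.
split; last by lra.
have -> : n * L / (160 * 8) = n / 16 / 10 * (L / 8) by field.
by apply: ler_wpM2l; [rewrite !divr_ge0//; lra|lra].
Qed.

Lemma torus_cover_ge (m : nat) (i : 'I_m * 'I_m) (W : walks R (@torus_adj m) 1 i) :
  (36 <= m)%N -> 16 <= ln ((m ^ 2)%:R : R) ->
  (((m ^ 2)%:R * ln (m ^ 2)%:R ^+ 2 / (160 * 128))%:E <= expected_cover_time W)%E.
Proof.
move=> m36 ln16.
have m2 : (2 < m)%N by lia.
(* [s] is the integer square root of [m]; [m < (s + 1) ^ 2 <= (2 * s) ^ 2] will give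
   [n <= (2 * s) ^ 4]. *)
have [s [s0 sm ms]] : exists s, [/\ (0 < s)%N, (s ^ 2 <= m)%N & (m < s.+1 ^ 2)%N].
  have ex : exists s, (s ^ 2 <= m)%N by exists 0%N.
  have bd s : (s ^ 2 <= m)%N -> (s <= m)%N by nia.
  case: (ex_maxnP ex bd) => s sm smax; exists s; split => //.
    by have := smax 1%N; lia.
  by rewrite ltnNge; apply/negP => /smax; lia.
have [A [As Afar]] := torus_separated m2 s0 sm.
have n80 : 16 * 80 <= (m ^ 2)%:R :> R.
  have m36R : 36 <= m%:R :> R by rewrite ler_nat.
  by rewrite natrX; nra.
have q80 : 80 <= (m ^ 2)%:R / 16 :> R by lra.
have s1 : 1 <= s%:R :> R by rewrite ler1n.
have ns : (m ^ 2)%:R <= (2 * s%:R) ^+ 4 :> R.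
  rewrite -natrM -natrX ler_nat -[4%N]/(2 * 2)%N expnM leq_exp2r//.
  by clear - ms s0; nia.
have sq : s%:R ^+ 2 + 1 <= (m ^ 2)%:R / 16 :> R.
  have m36R : 36 <= m%:R :> R by rewrite ler_nat.
  have smR : s%:R ^+ 2 <= m%:R :> R by rewrite -natrX ler_nat.
  by rewrite ler_pdivlMr// natrX; clear - smR m36R; nra.
have [hb lb] := hit_lower_matthews_bound n80 ln16 s1 ns.
set h := _ * (ln _ - 1) in hb.
set L := ln (m ^ 2)%:R in ln16 hb lb *.
have nL0 : 0 <= (m ^ 2)%:R * L / (160 * 8).
  by rewrite divr_ge0// mulr_ge0//; apply: le_trans ln16.
have h0 : 0 <= h by exact: le_trans hb.
(* The start may lie in [A], leaving [s - 1] points, and [ln s <= harmonic_sum (s - 1)]. *)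
have harm : L / 8 <= harmonic_sum #|A :\ i| - 1.
  have sA : (s.-1 <= #|A :\ i|)%N by rewrite -As (cardsD1 i A); case: (i \in A); rewrite ?leq_pred.
  have := le_harmonic_sum sA; have := ln_le_harmonic_sum s.-1.
  rewrite prednK//; clear - lb; lra.
have harm0 : 0 <= harmonic_sum #|A :\ i| - 1 :> R by apply: le_trans harm; clear - ln16; lra.
apply: (@le_trans _ _ (h * (harmonic_sum #|A :\ i| - 1) / 2)%:E).
  rewrite lee_fin.
  have -> : (m ^ 2)%:R * L ^+ 2 / (160 * 128) = ((m ^ 2)%:R * L / (160 * 8)) * (L / 8) / 2 by field.
  rewrite ler_pM2r ?invr_gt0//; apply: ler_pM => //.
  by clear - ln16; lra.
apply: (@expected_cover_time_ge _ _ _ (torus_step_sum1 m2 R) i W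
  (fun v x => hit_lower ((m ^ 2)%:R / 16) (torus_sqdist v x)) h A).
- by move=> v x; exact: hit_lower_ge0.
- by move=> v; rewrite torus_sqdistxx ?hit_lower0.
- exact: h0.
- by move=> v x _; exact: torus_hit_lower_step.
- move=> u v uA vA uv; apply: hit_lower_ge => //.
  + by rewrite lerDr exprn_ge0.
  + by rewrite lerD2r -natrX ler_nat Afar.
- by rewrite mulr_ge0.
Qed.

Lemma torus_many_walks_cover_ge (m k : nat) (i : 'I_m * 'I_m)
    (W : walks R (@torus_adj m) k i) :
  (2 < m)%N -> (1 <= k)%N ->
  (((m ^ 2)%:R / (144 * ln (4 * k%:R)))%:E <= expected_cover_time W)%E.
Proof.
move=> m2 k1.
have kR : 1 <= k%:R :> R by rewrite ler1n.
have [B BE] : exists B : R, B = ln (4 * k%:R) by eexists.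
have B0 : 0 < B by rewrite BE ln_gt0//; lra.
have eB : expR B = 4 * k%:R by rewrite BE lnK// posrE; lra.
rewrite -BE.
have m0 : 0 < m%:R :> R by rewrite ltr0n; lia.
(* [x] and [lam] are balanced: [2 * lam ^ 2 * x = B] bounds the growth by [exp B], while
   [lam * m./2 >= 2 * B], from [m./2 >= m / 3], makes the value at the antipode at least
   [exp (2 * B) / 2]. A walk then visits [z] with probability at most
   [2 * exp (- B) = 1 / (2 * k)]. *)
pose x : R := (m ^ 2)%:R / (72 * B).
have x0 : 0 <= x by rewrite divr_ge0// mulr_ge0//; lra.
have /andP[tx xt] := truncn_itv x0.
set t := Num.truncn x in tx xt.
pose lam := 6 * B / m%:R.
have lam0 : 0 <= lam by rewrite divr_ge0//; lra.
pose E := expR lam.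
have E1 : 1 <= E by rewrite /E -expR0 ler_expR.
have [a aE] := cycle_antipode m2 i.1.
pose z := (a, i.2).
have := @path_prob_visit_le R _ _ (@step_prob_ge0 R _ (@torus_adj m)) (torus_step_sum1 m2 R) z
  (fun y => cosh_pow E (cycle_dist i.1 y.1)) ((E + E^-1) / 2).
have c1 : 1 <= (E + E^-1) / 2.
  by have := @cosh_pow_mono R E E1 0 1 isT; rewrite /cosh_pow expr0 expr1 invr1; lra.
have G0 y : 0 <= cosh_pow E (cycle_dist i.1 y).
  by rewrite divr_ge0// addr_ge0 ?invr_ge0 ?exprn_ge0//; lra.
move=> /(_ c1 (fun y => G0 y.1) (fun y => torus_visit_step E1 i y m2) t i).
rewrite /= aE cycle_distxx // [cosh_pow E 0]/cosh_pow expr0 invr1.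
have -> : (1 + 1) / 2 = 1 :> R by field.
rewrite mulr1 => H.
pose pz := path_prob (step_prob (@torus_adj m)) t i (fun s => z \in i :: s) : R.
have cE : ((E + E^-1) / 2) ^+ t <= expR B.
  apply: (@le_trans _ _ (expR (2 * lam ^+ 2) ^+ t)).
    rewrite lerXn2r ?nnegrE ?expR_ge0//; first by lra.
    by have := expR_addN_le lam0; rewrite expRN -/E; lra.
  rewrite -expRM_natr ler_expR.
  have -> : B = 2 * lam ^+ 2 * x.
    by rewrite /lam /x natrX; field; rewrite !gt_eqF.
  by apply: ler_wpM2l tx; rewrite mulr_ge0// exprn_ge0.
have Gz : expR B ^+ 2 / 2 <= cosh_pow E m./2.
  apply: (@le_trans _ _ (E ^+ m./2 / 2)); last first.
    by rewrite ler_pM2r ?invr_gt0// lerDl invr_ge0 exprn_ge0//; lra.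
  rewrite ler_pM2r ?invr_gt0// /E -!expRM_natr ler_expR.
  have m3 : m%:R <= 3 * (m./2)%:R :> R by rewrite -natrM ler_nat; clear - m2; lia.
  by rewrite /lam mulrAC ler_pdivlMr//; nra.
have pz0 : 0 <= pz by apply: path_prob_ge0; exact: step_prob_ge0.
have pzk : pz <= (2 * k%:R)^-1.
  have H2 : pz * (expR B ^+ 2 / 2) <= expR B.
    by apply: le_trans cE; apply: le_trans H; apply: ler_wpM2l.
  move: H2; rewrite eB => H2.
  rewrite -[_^-1]mul1r ler_pdivlMr; last by lra.
  by nra.
have := expected_cover_time_ge_visit (walks_srw W) pzk.
apply: le_trans; rewrite lee_fin.
have -> : 1 - k%:R / (2 * k%:R) = 2^-1 :> R by field; rewrite gt_eqF//; lra.
have -> : (m ^ 2)%:R / (144 * B) = x / 2 :> R by rewrite /x; field; rewrite gt_eqF.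
by rewrite ler_pM2r ?invr_gt0// ltW.
Qed.

End estimates.

(** * Speed-up *)

Section max_cover.
Context {R : realType} {V : finType} {e : rel V} {k : nat}.
Variable W : forall i : V, walks R e k i.

Lemma max_cover_time_le (c : R) :
  (forall i, (expected_cover_time (W i) <= c%:E)%E) -> (max_cover_time W <= c%:E)%E.
Proof. by move=> H; apply: bigmax_le => //; rewrite leNye. Qed.

Lemma max_cover_time_ge (c : R) (i : V) :
  (c%:E <= expected_cover_time (W i))%E -> (c%:E <= max_cover_time W)%E.
Proof. by move=> H; apply: le_trans H _; exact: le_bigmax. Qed.

End max_cover.

Section speedup_bounds.
Context {R : realType} {V : finType} {e : rel V} {k : nat}.
Variables (W1 : forall i : V, walks R e 1 i) (Wk : forall i : V, walks R e k i).

Lemma speedup_ge (a b : R) : 0 <= a -> 0 < b ->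
  (a%:E <= max_cover_time W1)%E -> (0 <= max_cover_time Wk <= b%:E)%E ->
  ((a / b)%:E <= speedup W1 Wk)%E.
Proof.
move=> a0 b0 H1 /andP[Hk0 Hk]; rewrite /speedup EFinM.
have bE : (b^-1)%:E = (b%:E^-1)%E by rewrite inver gt_eqF.
rewrite bE; apply: lee_pmul => //; first by rewrite -bE lee_fin invr_ge0 ltW.
by rewrite lee_pV2 ?inE// lee_fin ltW.
Qed.

Lemma speedup_le (a b : R) : 0 < b ->
  (0 <= max_cover_time W1 <= a%:E)%E -> (b%:E <= max_cover_time Wk)%E ->
  (speedup W1 Wk <= (a / b)%:E)%E.
Proof.
move=> b0 /andP[H10 H1] Hk; rewrite /speedup EFinM.
have Hk0 : (0 <= max_cover_time Wk)%E by apply: le_trans Hk; rewrite lee_fin ltW.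
have bE : (b^-1)%:E = (b%:E^-1)%E by rewrite inver gt_eqF.
rewrite bE; apply: lee_pmul => //; first by rewrite inve_ge0.
by rewrite lee_pV2 ?inE// lee_fin ltW.
Qed.

End speedup_bounds.

(** Put [w = sqrt u] and [K = w ^ 6 * s] with [w, s >= 1]; bounding each logarithm linearly gives
    [ln (4 * K) <= 9 * w * s]. Used with [u = ln n] and [K = k]. *)
Lemma sqr_mul_ln_le (R : realType) (u K : R) : 1 <= u -> u ^+ 3 <= K ->
  u ^+ 2 * ln (4 * K) <= 9 / Num.sqrt u * K.
Proof.
move=> u1 uK; have u0 : 0 < u by lra.
have [w [w1 wE]] : exists w, 1 <= w /\ u = w ^+ 2.
  exists (Num.sqrt u); split; last by rewrite sqr_sqrtr// ltW.
  by rewrite -[leLHS]sqrtr1; exact: ler_wsqrtr.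
have w0 : 0 < w by lra.
have -> : Num.sqrt u = w by rewrite wE sqrtr_sqr ger0_norm// ltW.
have [s [s1 sE]] : exists s, 1 <= s /\ K = u ^+ 3 * s.
  exists (K / u ^+ 3); split; last by rewrite mulrC divfK// expf_neq0// gt_eqF.
  by rewrite ler_pdivlMr ?exprn_gt0// mul1r.
rewrite sE wE.
have -> : 4 * ((w ^+ 2) ^+ 3 * s) = (2 * w ^+ 3) ^+ 2 * s by ring.
have w3 : 0 < w ^+ 3 by rewrite exprn_gt0.
have s0 : 0 < s by lra.
rewrite lnM ?posrE ?exprn_gt0 ?mulr_gt0// lnXn ?mulr_gt0// lnM ?posrE// lnXn//.
have l2 : ln 2 <= 1 :> R by have := @ln_le_sub1 R 2 (ltr0Sn _ 1); lra.
have lw := ln_le_sub1 w0; have ls := ln_le_sub1 s0.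
have H : (ln 2 + ln w *+ 3) *+ 2 + ln s <= 9 * w * s.
  have : (ln 2 + ln w *+ 3) *+ 2 + ln s <= 6 * w - 4 + s - 1 by lra.
  by nra.
have -> : 9 / w * ((w ^+ 2) ^+ 3 * s) = (w ^+ 2) ^+ 2 * (9 * w * s) by field; rewrite gt_eqF.
by apply: ler_wpM2l => //; rewrite exprn_ge0// exprn_ge0// ltW.
Qed.

Lemma ln_large (R : realType) (x : R) : exists N : nat, forall m : nat,
  (N <= m ^ 2)%N -> (36 <= m)%N /\ x <= ln ((m ^ 2)%:R : R).
Proof.
exists (maxn (36 ^ 2) (Num.bound (expR x))) => m.
rewrite geq_max leq_exp2r// => /andP[m36 mx]; split => //.
have m0 : (0 < m)%N by exact: leq_trans m36.
rewrite -[x]expRK ler_ln ?posrE ?expR_gt0 ?ltr0n ?expn_gt0 ?m0//.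
apply: (@le_trans _ _ (Num.bound (expR x))%:R); last by rewrite ler_nat.
exact/ltW/archi_boundP/expR_ge0.
Qed.

Theorem theorem8 (R : realType) :
  (exists (c : R) (N : nat), 0 < c /\
     forall m k : nat, (N <= m ^ 2)%N ->
       (1 <= k)%N -> k%:R <= ln ((m ^ 2)%N%:R : R) ->
       forall (W1 : forall i, walks R (@torus_adj m) 1 i)
              (Wk : forall i, walks R (@torus_adj m) k i),
         ((c * k%:R)%:E <= speedup W1 Wk)%E)
  /\
  (forall delta : R, 0 < delta ->
     exists N : nat,
     forall m k : nat, (N <= m ^ 2)%N ->
       ln ((m ^ 2)%N%:R : R) ^+ 3 <= k%:R ->
       forall (W1 : forall i, walks R (@torus_adj m) 1 i)
              (Wk : forall i, walks R (@torus_adj m) k i),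
         (speedup W1 Wk <= (delta * k%:R)%:E)%E).
Proof.
(* The maximum starts from [-oo], so its nonnegativity has to come from the bound at some vertex
   [i]. *)
have many_pos (m k : nat) (i : 'I_m * 'I_m) (Wk : forall i, walks R (@torus_adj m) k i) :
    (2 < m)%N -> (1 <= k)%N -> (0 <= max_cover_time Wk)%E.
  move=> m2 k1; apply: (@max_cover_time_ge _ _ _ _ _ 0 i).
  apply: le_trans (torus_many_walks_cover_ge (Wk i) m2 k1).
  have k1R : 1 <= k%:R :> R by rewrite ler1n.
  have l0 : 0 <= ln (4 * k%:R) :> R by apply: ln_ge0; lra.
  by rewrite lee_fin divr_ge0// mulr_ge0.
split.
  have [N HN] := @ln_large R 16.
  (* The constants of [torus_cover_le] and [torus_cover_ge]; the quotient of the two bounds is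
     exactly [c * k]. *)
  exists (16 * (160 * 128))^-1, N; split; first by rewrite invr_gt0 !mulr_gt0.
  move=> m k /HN[m36 ln16] k1 kln W1 Wk.
  have m12 : (12 <= m)%N by exact: leq_trans m36.
have m2 : (2 < m)%N by exact: leq_trans m12.
  have m0 : (0 < m)%N by exact: leq_trans m36.
  pose i : 'I_m * 'I_m := (Ordinal m0, Ordinal m0).
  have up := max_cover_time_le (fun j => torus_cover_le (Wk j) m12 k1 kln).
  have lo := max_cover_time_ge (torus_cover_ge (W1 i) m36 ln16).
  have {}up := introT andP (conj (many_pos m k i Wk m2 k1) up).
  have n0 : 0 < (m ^ 2)%:R :> R by rewrite ltr0n expn_gt0 m0.
  have kR : 0 < k%:R :> R by rewrite ltr0n.
  move: up lo n0 kln ln16; move: ((m ^ 2)%:R : R) => n up lo n0 kln ln16.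
  have L0 : 0 < ln n by lra.
  apply: le_trans (speedup_ge _ _ lo up).
  - rewrite lee_fin le_eqVlt; apply/orP; left; apply/eqP; field.
    by rewrite !gt_eqF.
  - by rewrite divr_ge0// mulr_ge0 ?exprn_ge0// ltW.
  - by rewrite divr_gt0// !mulr_gt0// exprn_gt0.
move=> delta d0.
(* [144 ^ 2 = 16 * 144 * 9] collects the constants of the two cover time bounds and of
   [sqr_mul_ln_le]. The square yields [sqrt (ln n) >= 144 ^ 2 / delta], and the added 1 yields
   [ln n >= 1]. *)
have [N HN] := ln_large (1 + (144 ^+ 2 / delta) ^+ 2).
exists N => m k /HN[m36 lnd] kln W1 Wk.
have m12 : (12 <= m)%N by exact: leq_trans m36.
have m2 : (2 < m)%N by exact: leq_trans m12.
have m0 : (0 < m)%N by exact: leq_trans m36.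
pose i : 'I_m * 'I_m := (Ordinal m0, Ordinal m0).
have n0 : 0 < (m ^ 2)%:R :> R by rewrite ltr0n expn_gt0 m0.
have L1 : 1 <= ln (m ^ 2)%:R :> R by have := sqr_ge0 (144 ^+ 2 / delta); lra.
have kR : 1 <= k%:R :> R by apply: le_trans kln; rewrite exprn_ege1.
have k1 : (1 <= k)%N by rewrite -(ler1n R).
have up := max_cover_time_le (fun j => torus_cover_le (W1 j) m12 (leqnn 1) L1).
have lo := max_cover_time_ge (torus_many_walks_cover_ge (Wk i) m2 k1).
have ln4k : 0 < ln (4 * k%:R) :> R by rewrite ln_gt0//; lra.
have {}up := introT andP (conj (many_pos m 1%N i W1 m2 (leqnn 1)) up).
apply: le_trans (speedup_le _ up lo) _.
  by rewrite divr_gt0// mulr_gt0.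
move: n0 L1 lnd kln {up lo HN m36}; move: ((m ^ 2)%:R : R) => n n0 L1 lnd kln.
have := sqr_mul_ln_le L1 kln.
rewrite lee_fin => H.
have -> : 16 * n * ln n ^+ 2 / 1 / (n / (144 * ln (4 * k%:R))) = 16 * 144 * (ln n ^+ 2 * ln (4 * k%:R)).
  by field; rewrite !gt_eqF.
have x0 : 0 <= 144 ^+ 2 / delta by rewrite divr_ge0 ?sqr_ge0// ltW.
have sq : 144 ^+ 2 / delta <= Num.sqrt (ln n).
  rewrite -(ger0_norm x0) -sqrtr_sqr; apply: ler_wsqrtr.
  by move: lnd; move: (144 ^+ 2 / delta) => x; lra.
have sq0 : 0 < Num.sqrt (ln n) by rewrite sqrtr_gt0; lra.
apply: (@le_trans _ _ (16 * 144 * (9 / Num.sqrt (ln n) * k%:R))); first by rewrite ler_pM2l.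
rewrite !mulrA ler_wpM2r// ler_pdivrMr//.
move: sq; rewrite ler_pdivrMr//.
by move: (Num.sqrt (ln n)) => w; rewrite expr2; lra.
Qed.
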